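(* Let $\mathcal{H}$ be a real Hilbert space, let $\mathbb{H}=\{(x,t_{x})\in\mathcal{H}\times(0,\infty): t_{x}^{2}-\|x\|^{2}=1\}$ be the associated real hyperbolic space, with $[(x,t_{x}),(y,t_{y})]:=t_{x}t_{y}-\langle x,y\rangle\in[1,\infty)$ and metric $d(z,w)=\operatorname{arccosh}([z,w])$. For every $r>0$ the kernel $$H_{r}:\mathbb{H}\times\mathbb{H}\to\mathbb{R},\qquad H_{r}(z,w):=[z,w]^{-r}=\operatorname{sech}(d(z,w))^{r},$$ is integrally strictly positive definite (ISPD).
   Context: $\mathbb{H}$ carries the topology of the metric $d$ (which coincides with the topology induced from $\mathcal{H}\times\mathbb{R}$). $\mathcal{H}$ may be infinite dimensional and is not assumed separable. A kernel $K:X\times X\to\mathbb{C}$ is positive definite if $\sum_{\mu,\nu=1}^{n}c_{\mu}\overline{c_{\nu}}K(x_{\mu},x_{\nu})\ge 0$ for all finitely many distinct points $x_{\mu}\in X$ and scalars $c_{\mu}\in\mathbb{C}$. Its reproducing kernel Hilbert space $\mathcal{H}_{K}$ is the Hilbert space of functions $F:X\to\mathbb{C}$ that contains $K_{y}:=K(\cdot,y)$ for every $y\in X$, satisfies $\langle F,K_{y}\rangle_{\mathcal{H}_{K}}=F(y)$, and in which $\mathrm{span}\{K_{y}:y\in X\}$ is dense. $\mathcal{M}(X)$ denotes the finite complex-valued Radon measures on $X$: complex Borel measures $\lambda$ with $|\lambda|$ finite and, for every Borel $E$, $|\lambda|(E)=\sup\{|\lambda|(K):K\subset E\text{ compact}\}=\inf\{|\lambda|(U):U\supset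 E\text{ open}\}$. A bounded positive definite kernel $K$ on a Hausdorff space $X$ with $\mathcal{H}_{K}\subset C(X)$ is ISPD if the only $\lambda\in\mathcal{M}(X)$ with $\int_{X}\int_{X}K(x,y)\,d\lambda(x)\,d\overline{\lambda}(y)=0$ is the zero measure. *)

(* Defs.v *)
From HB Require Import structures.
From mathcomp Require Import all_boot all_order all_algebra.
From mathcomp Require Import ring lra.
From mathcomp Require Import complex.
From mathcomp Require Import all_classical all_reals all_analysis.

Set Implicit Arguments.
Unset Strict Implicit.
Unset Printing Implicit Defensive.

Import Order.TTheory GRing.Theory Num.Theory.
Import numFieldNormedType.Exports.

Local Open Scope classical_set_scope.
Local Open Scope ring_scope.
Local Open Scope complex_scope.

HB.mixin Record NormedModule_isHilbert (R : realType) V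
    of CompleteNormedModule R V := {
  inner : {dot V for (idfun : R -> R)};
  inner_norm : forall x : V, inner x x = `|x| ^+ 2
}.

#[short(type="hilbertType")]
HB.structure Definition Hilbert (R : realType) :=
  {V of NormedModule_isHilbert R V & CompleteNormedModule R V}.

Section hyperbolic_functions.
Context {R : realType}.
Implicit Types a b x : R.

Definition cosh x : R := (expR x + expR (- x)) / 2.
Definition sech x : R := (cosh x)^-1.
Definition arccosh x : R := ln (x + Num.sqrt (x ^+ 2 - 1)).

Lemma arccoshK a : 1 <= a -> cosh (arccosh a) = a.
Proof.
move=> a1; rewrite /cosh /arccosh expRN.
have s0 : 0 <= Num.sqrt (a ^+ 2 - 1) by exact: sqrtr_ge0.
have s2 : Num.sqrt (a ^+ 2 - 1) ^+ 2 = a ^+ 2 - 1 by rewrite sqr_sqrtr//; nra.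
set s := Num.sqrt _ in s0 s2 *.
have p0 : 0 < a + s by lra.
rewrite lnK ?posrE//.
have -> : (a + s)^-1 = a - s.
  apply: (mulfI (lt0r_neq0 p0)); rewrite divff ?gt_eqF//.
  by rewrite mulrC -subr_sqr s2; ring.
by field.
Qed.

Lemma arccosh1 : arccosh 1 = 0.
Proof. by rewrite /arccosh expr1n subrr sqrtr0 addr0 ln1. Qed.

Lemma le_arccosh_add a b c : 1 <= a -> 1 <= b -> 1 <= c ->
  (c - a * b) ^+ 2 <= (a ^+ 2 - 1) * (b ^+ 2 - 1) ->
  arccosh c <= arccosh a + arccosh b.
Proof.
move=> a1 b1 c1 h; rewrite /arccosh.
have s0 := sqrtr_ge0 (a ^+ 2 - 1); have t0 := sqrtr_ge0 (b ^+ 2 - 1).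
have s2 : Num.sqrt (a ^+ 2 - 1) ^+ 2 = a ^+ 2 - 1 by rewrite sqr_sqrtr//; nra.
have t2 : Num.sqrt (b ^+ 2 - 1) ^+ 2 = b ^+ 2 - 1 by rewrite sqr_sqrtr//; nra.
set s := Num.sqrt (a ^+ 2 - 1) in s0 s2 *.
set t := Num.sqrt (b ^+ 2 - 1) in t0 t2 *.
have cle : c <= a * b + s * t.
  rewrite -lerBlDl; apply: (le_trans (ler_norm _)).
  rewrite -(@ler_pXn2r _ 2)// ?nnegrE ?mulr_ge0//.
  by rewrite real_normK ?num_real// exprMn s2 t2.
have d0 : 0 <= a * t + b * s by rewrite addr_ge0 ?mulr_ge0//; lra.
have dE : (a * t + b * s) ^+ 2 = (a * b + s * t) ^+ 2 - 1.
  have -> : (a * t + b * s) ^+ 2 =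
    a ^+ 2 * t ^+ 2 + b ^+ 2 * s ^+ 2 + 2 * (a * b * (s * t)) by ring.
  have -> : (a * b + s * t) ^+ 2 =
    a ^+ 2 * b ^+ 2 + s ^+ 2 * t ^+ 2 + 2 * (a * b * (s * t)) by ring.
  by rewrite s2 t2; ring.
have ule : Num.sqrt (c ^+ 2 - 1) <= a * t + b * s.
  rewrite -[leRHS]ger0_norm// -sqrtr_sqr ler_wsqrtr// dE lerD2r.
  by rewrite ler_pXn2r// nnegrE; [lra|apply: le_trans cle; lra].
have u0 := sqrtr_ge0 (c ^+ 2 - 1).
rewrite -lnM ?posrE; [|lra|lra].
rewrite ler_ln ?posrE; [|lra|by apply: mulr_gt0; lra].
have -> : (a + s) * (b + t) = (a * b + s * t) + (a * t + b * s) by ring.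
exact: lerD.
Qed.

Lemma discr_le a b c : 0 <= c ->
  (forall x, 0 <= a + 2 * x * b + x ^+ 2 * c) -> b ^+ 2 <= a * c.
Proof.
rewrite le_eqVlt => /orP[/eqP <- h|c0 h].
  have [->|b0] := eqVneq b 0; first by rewrite mulr0 expr0n.
  have := h (- (a + 1) / (2 * b)); rewrite mulr0 addr0.
  have -> : a + 2 * (- (a + 1) / (2 * b)) * b = -1 by field.
  by rewrite oppr_ge0 ler10.
have := h (- b / c).
have -> : a + 2 * (- b / c) * b + (- b / c) ^+ 2 * c = a - b ^+ 2 / c.
  by field; rewrite gt_eqF.
by rewrite subr_ge0 ler_pdivrMr.
Qed.

End hyperbolic_functions.

Section hyperbolic_space.
Context {R : realType} (V : hilbertType R).
Implicit Types (x y : V) (p q u v : V * R).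

Definition mink p q : R := p.2 * q.2 - inner p.1 q.1.

Record hyperbolic := Hyperbolic {
  hval :> V * R;
  hvalP : (0 < hval.2) && (hval.2 ^+ 2 - `|hval.1| ^+ 2 == 1)
}.

HB.instance Definition _ := [isSub of hyperbolic for hval].
HB.instance Definition _ := [Choice of hyperbolic by <:].

Implicit Types z w : hyperbolic.

Definition bracket z w : R := mink z w.
Definition hdist z w : R := arccosh (bracket z w).

Lemma innerC x y : inner x y = inner y x.
Proof. by rewrite hermC expr0 mul1r. Qed.

Lemma innerDl x x' y : inner (x + x') y = inner x y + inner x' y.
Proof. exact: linearDl. Qed.

Lemma innerZl (a : R) x y : inner (a *: x) y = a * inner x y.
Proof. exact: linearZl_LR. Qed.

Lemma innerDr x y y' : inner x (y + y') = inner x y + inner x y'.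
Proof. by rewrite innerC innerDl !(innerC x). Qed.

Lemma innerZr (a : R) x y : inner x (a *: y) = a * inner x y.
Proof. by rewrite innerC innerZl innerC. Qed.

Lemma inner0l x : inner 0 x = 0.
Proof. by rewrite -(scale0r x) innerZl mul0r. Qed.

Lemma inner_ge0 x : 0 <= inner x x.
Proof. by rewrite inner_norm exprn_ge0. Qed.

Lemma minkC p q : mink p q = mink q p.
Proof. by rewrite /mink innerC mulrC. Qed.

Lemma minkDl p q u : mink (p + q) u = mink p u + mink q u.
Proof. by rewrite /mink /= innerDl; ring. Qed.

Lemma minkZl (a : R) p u : mink (a *: p) u = a * mink p u.
Proof. by rewrite /mink /= innerZl mulrBr mulrA. Qed.

Lemma minkDr p q u : mink u (p + q) = mink u p + mink u q.
Proof. by rewrite minkC minkDl !(minkC u). Qed.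

Lemma minkZr (a : R) p u : mink u (a *: p) = a * mink u p.
Proof. by rewrite minkC minkZl !(minkC u). Qed.

Lemma inner_CS x y : inner x y ^+ 2 <= inner x x * inner y y.
Proof.
apply: discr_le => [|s]; first exact: inner_ge0.
have := inner_ge0 (x + s *: y).
rewrite innerDl !innerDr !innerZl !innerZr (innerC y x).
by congr (_ <= _); ring.
Qed.

Lemma hyp_gt0 z : 0 < (z : V * R).2.
Proof. by case: z => p /= /andP[]. Qed.

Lemma hyp_eq z : (z : V * R).2 ^+ 2 - `|(z : V * R).1| ^+ 2 = 1.
Proof. by case: z => p /= /andP[_ /eqP]. Qed.

Lemma bracketxx z : bracket z z = 1.
Proof. by rewrite /bracket /mink inner_norm -expr2 hyp_eq. Qed.

Lemma mink_orth z u : mink z u = 0 ->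
  (z : V * R).2 ^+ 2 * mink u u <= - inner u.1 u.1.
Proof.
have := hyp_gt0 z; have := bracketxx z; rewrite /bracket /mink.
case: (hval z) => b t /= + t0; case: u => a s /= tb.
move/eqP; rewrite subr_eq0 => /eqP tsE.
have := inner_CS b a; rewrite -tsE => cs.
have -> : t ^+ 2 * (s * s - inner a a) = (t * s) ^+ 2 - t ^+ 2 * inner a a.
  by ring.
have -> : t ^+ 2 = 1 + inner b b by rewrite -tb; ring.
rewrite lerBlDr; apply: le_trans cs _; rewrite mulrDl mul1r.
by rewrite addrA addNr add0r.
Qed.

Lemma mink_orth_le0 z u : mink z u = 0 -> mink u u <= 0.
Proof.
move=> /mink_orth h; have t0 : 0 < (z : V * R).2 ^+ 2.
  by rewrite exprn_gt0 ?hyp_gt0.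
by rewrite -(pmulr_rle0 _ t0) (le_trans h)// oppr_le0 inner_ge0.
Qed.

Lemma mink_orth_eq0 z u : mink z u = 0 -> mink u u = 0 -> u = 0.
Proof.
move=> h u0; have := mink_orth h; rewrite u0 mulr0 oppr_ge0 inner_norm.
move=> n0; have /eqP : `|u.1| ^+ 2 = 0.
  by apply/eqP; rewrite eq_le n0 exprn_ge0.
rewrite sqrf_eq0 normr_eq0 => /eqP u10.
move: h u10; case: u {n0 u0} => a s /= h a0; congr pair => //.
move: h; rewrite /mink /= a0 innerC inner0l subr0 => /eqP.
by rewrite mulf_eq0 gt_eqF ?hyp_gt0//= => /eqP.
Qed.

Definition horth z w : V * R := (z : V * R) - bracket z w *: (w : V * R).

Lemma mink_horth z z' w : mink (horth z w) (horth z' w) =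
  bracket z z' - bracket z w * bracket z' w.
Proof.
rewrite /horth -!(scaleNr _ (w : V * R)) minkDl !minkDr !minkZl !minkZr.
have -> : mink w w = 1 by exact: bracketxx.
rewrite -/(bracket z w) -/(bracket z z') (minkC w z') -/(bracket z' w).
by ring.
Qed.

Lemma horth_orth z w : mink w (horth z w) = 0.
Proof.
rewrite /horth -(scaleNr _ (w : V * R)) minkDr minkZr (minkC w z).
rewrite -/(bracket z w) mulNr.
have -> : mink w w = 1 by exact: bracketxx.
by rewrite mulr1 subrr.
Qed.

Lemma bracket_ge1 z w : 1 <= bracket z w.
Proof.
have := mink_orth_le0 (horth_orth z w).
rewrite mink_horth bracketxx subr_le0 -expr2 => q1.
have q0 : 0 <= bracket z w.
  rewrite /bracket /mink subr_ge0 (le_trans (ler_norm _))//.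
  have z0 := hyp_gt0 z; have w0 := hyp_gt0 w.
  rewrite -(@ler_pXn2r _ 2)// ?nnegrE ?mulr_ge0 ?(ltW z0) ?(ltW w0)//.
  rewrite real_normK ?num_real//; apply: (le_trans (inner_CS _ _)).
  rewrite exprMn !inner_norm ler_pM// ?exprn_ge0//.
    by have := hyp_eq z; lra.
  by have := hyp_eq w; lra.
by rewrite -(@ler_pXn2r _ 2)// ?nnegrE// expr1n.
Qed.

Lemma bracketC z w : bracket z w = bracket w z.
Proof. exact: minkC. Qed.

Lemma hdistxx z : hdist z z = 0.
Proof. by rewrite /hdist bracketxx arccosh1. Qed.

Lemma hdist_positivity z w : hdist z w = 0 -> z = w.
Proof.
move=> d0; have := arccoshK (bracket_ge1 z w); rewrite -/(hdist z w) d0.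
rewrite /cosh oppr0 expR0 => b1.
have {}b1 : bracket z w = 1 by rewrite -b1; field.
apply: val_inj => /=; apply/eqP; rewrite -subr_eq0 -[X in _ - X]scale1r -b1.
apply/eqP; apply: (mink_orth_eq0 (horth_orth z w)).
by rewrite mink_horth bracketxx b1 mulr1 subrr.
Qed.

Lemma hdist_sym z w : hdist z w = hdist w z.
Proof. by rewrite /hdist bracketC. Qed.

Lemma hdist_triangle w z z' : hdist z z' <= hdist z w + hdist w z'.
Proof.
rewrite (hdist_sym w); apply: le_arccosh_add; rewrite ?bracket_ge1//.
set u := horth z w; set v := horth z' w.
have -> : bracket z z' - bracket z w * bracket z' w = mink u v.
  by rewrite mink_horth.
have -> : bracket z w ^+ 2 - 1 = - mink u u.
  by rewrite mink_horth bracketxx opprB.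
have -> : bracket z' w ^+ 2 - 1 = - mink v v.
  by rewrite mink_horth bracketxx opprB.
have uw : mink w u = 0 by exact: horth_orth.
have vw : mink w v = 0 by exact: horth_orth.
clearbody u v; rewrite -sqrrN; apply: discr_le => [|s].
  by rewrite oppr_ge0 (mink_orth_le0 vw).
have : mink w (u + s *: v) = 0 by rewrite minkDr minkZr uw vw mulr0 addr0.
move/mink_orth_le0; rewrite -oppr_ge0.
rewrite minkDl !minkDr !minkZl !minkZr (minkC v u).
by congr (_ <= _); ring.
Qed.

(* so the topology of [hyperbolic] is the one given by the balls of [hdist] *)
HB.instance Definition _ := isMetric.Build R hyperbolic
  hdistxx hdist_positivity hdist_sym hdist_triangle.

Lemma hyperbolic_base_subproof :
  (0 < ((0, 1) : V * R).2) &&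
  (((0, 1) : V * R).2 ^+ 2 - `|((0, 1) : V * R).1| ^+ 2 == 1).
Proof. by rewrite /= ltr01 normr0 expr0n expr1n subr0 eqxx. Qed.

HB.instance Definition _ :=
  isPointed.Build hyperbolic (Hyperbolic hyperbolic_base_subproof).

Lemma hyp_mdistE z w : mdist z w = hdist z w.
Proof. by []. Qed.

Definition hkernel (r : R) z w : R := bracket z w `^ (- r).

End hyperbolic_space.

Section reproducing_kernels.
Context {R : realType}.

Definition pos_def_kernel (X : Type) (K : X -> X -> R[i]) :=
  forall (n : nat) (x : 'I_n -> X) (c : 'I_n -> R[i]), injective x ->
    0 <= \sum_(i < n) \sum_(j < n) c i * (c j)^* * K (x i) (x j).

Definition bounded_kernel (X : Type) (K : X -> X -> R[i]) :=
  exists M : R, forall x y, `|K x y| <= M%:C.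

Definition fnorm (X : Type) (ip : (X -> R[i]) -> (X -> R[i]) -> R[i])
    (f : X -> R[i]) : R :=
  Num.sqrt (complex.Re (ip f f)).

(* [H] is a linear subspace of the functions X -> C, Hilbert for [ip], which is
   linear in its first argument; outside [H] the values of [ip] are junk *)
Record rkhs (X : Type) (K : X -> X -> R[i]) (H : set (X -> R[i]))
    (ip : (X -> R[i]) -> (X -> R[i]) -> R[i]) : Prop := {
  rkhs0 : H (fun=> 0);
  rkhs_lin : forall a f g, H f -> H g -> H (fun x => a * f x + g x);
  rkhs_iplin : forall a f g h, H f -> H g -> H h ->
    ip (fun x => a * f x + g x) h = a * ip f h + ip g h;
  rkhs_ipC : forall f g, H f -> H g -> ip f g = (ip g f)^*;
  rkhs_ip_gt0 : forall f, H f -> f <> (fun=> 0) -> 0 < ip f f;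
  rkhs_complete : forall f_ : nat -> X -> R[i], (forall n, H (f_ n)) ->
    (forall e : R, 0 < e -> exists N, forall m n, (N <= m)%N -> (N <= n)%N ->
      fnorm ip (f_ m \- f_ n) < e) ->
    exists2 f, H f &
      forall e : R, 0 < e -> exists N, forall n, (N <= n)%N ->
        fnorm ip (f_ n \- f) < e;
  rkhs_kernel : forall y, H (K ^~ y);
  rkhs_reproducing : forall f y, H f -> ip f (K ^~ y) = f y;
  rkhs_dense : forall f, H f -> forall e : R, 0 < e ->
    exists (n : nat) (c : 'I_n -> R[i]) (y : 'I_n -> X),
      let g := fun x => \sum_(i < n) c i * K x (y i) in
      fnorm ip (f \- g) < e
}.

(* R[i] carries no topology in the library: C is topologized as R x R *)
Definition continuousC (X : topologicalType) (f : X -> R[i]) :=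
  continuous (fun x => complex.Re (f x)) /\
  continuous (fun x => complex.Im (f x)).

End reproducing_kernels.

Section radon_measures.
Context {R : realType} (X : ptopologicalType).

Definition borelType := g_sigma_algebraType (@open X).

Local Notation borel := (measurable : set (set borelType)).

(* charges of mathcomp-analysis are finite signed measures *)
Record cmeasure := CMeasure {
  cmeasure_Re : {charge set borelType -> \bar R};
  cmeasure_Im : {charge set borelType -> \bar R}
}.

Definition cmeasure_val (l : cmeasure) (A : set borelType) : R[i] :=
  fine (cmeasure_Re l A) +i* fine (cmeasure_Im l A).

Coercion cmeasure_val : cmeasure >-> Funclass.

(* the norm of R[i] is R[i]-valued, hence complex.Re *)
Definition cmeasure_variation (l : cmeasure) (E : set borelType) : \bar R :=
  ereal_sup [set (\sum_(0 <= k <oo) (complex.Re `|l (F k)|)%:E)%E |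
    F in [set F : nat -> set borelType | [/\ forall k, borel (F k),
      trivIset setT F & \bigcup_k F k = E]]].

Definition radon (l : cmeasure) :=
  (cmeasure_variation l setT < +oo)%E /\
  forall E, borel E ->
    cmeasure_variation l E = ereal_sup [set cmeasure_variation l C |
      C in [set C : set X | compact C /\ C `<=` E]] /\
    cmeasure_variation l E = ereal_inf [set cmeasure_variation l U |
      U in [set U : set X | open U /\ E `<=` U]].

(* the Jordan decomposition does not depend on the Hahn decomposition chosen,
   cf. Hahn_decomposition_uniq *)
Definition charge_hahn (nu : {charge set borelType -> \bar R}) :
    {PN : set borelType * set borelType | hahn_decomposition nu PN.1 PN.2} :=
  cid (let: ex_intro P (ex_intro N h) := Hahn_decomposition nu in
       ex_intro _ (P, N) h).

Definition charge_integral (nu : {charge set borelType -> \bar R})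
    (f : X -> R) : R :=
  Rintegral (jordan_pos (svalP (charge_hahn nu))) setT f -
  Rintegral (jordan_neg (svalP (charge_hahn nu))) setT f.

Definition cintegral (l : cmeasure) (f : X -> R[i]) : R[i] :=
  (charge_integral (cmeasure_Re l) (fun x => complex.Re (f x)) -
   charge_integral (cmeasure_Im l) (fun x => complex.Im (f x))) +i*
  (charge_integral (cmeasure_Re l) (fun x => complex.Im (f x)) +
   charge_integral (cmeasure_Im l) (fun x => complex.Re (f x))).

Definition cmeasure_conj (l : cmeasure) : cmeasure :=
  CMeasure (cmeasure_Re l) (copp (cmeasure_Im l)).

End radon_measures.

(* A positive definite K has exactly one reproducing kernel Hilbert space
   (Moore-Aronszajn), so quantifying over (H, ip) speaks about H_K *)
Definition ISPD (R : realType) (X : ptopologicalType) (K : X -> X -> R[i]) :=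
  [/\ hausdorff_space X,
      bounded_kernel K,
      pos_def_kernel K,
      (forall H ip, rkhs K H ip -> forall f, H f -> continuousC f) &
      forall l : cmeasure X, radon l ->
        cintegral (cmeasure_conj l) (fun y => cintegral l (K ^~ y)) = 0 ->
        forall E, measurable E -> l E = 0].

(* Main.v *)
Require Import Defs.
From HB Require Import structures.
From mathcomp Require Import all_boot all_order all_algebra.
From mathcomp Require Import ring lra complex.
From mathcomp Require Import all_classical all_reals all_analysis measurable_realfun.

Set Implicit Arguments.
Unset Strict Implicit.
Unset Printing Implicit Defensive.
Import Order.TTheory GRing.Theory Num.Theory.
Import numFieldNormedType.Exports.
Local Open Scope classical_set_scope.
Local Open Scope ring_scope.
Local Open Scope complex_scope.

(* In the Klein model u = x / t of the hyperbolic space, [z,w] equals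
   t_z t_w (1 - <u_z,u_w>), so H_r(z,w) = t_z^-r t_w^-r (1 - <u_z,u_w>)^-r has
   the positive binomial coefficients as power series coefficients in <u_z,u_w>.
   By the Schur product theorem H_r is positive definite.  These coefficients
   dominate a multiple c > 0 of those of exp(s <u_z,u_w>), hence H_r - c E_s is
   positive definite too, where E_s = t_z^-r t_w^-r exp(s <u_z,u_w>).

   The energy of a tight signed measure for a bounded continuous positive
   definite kernel is a limit of quadratic forms, hence nonnegative.  Zero energy
   for H_r thus forces zero energy for every E_s, and perturbing the measure by
   point masses gives that the integral of t^-r exp(<u,v>) vanishes for all v.

   The bounded functions by which the integrands can be multiplied while all
   these integrals still vanish form an algebra closed under bounded pointwise
   limits.  It contains exp(-exp(n (n (<u,v> - c) + 1))), whose limit in n is the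
   indicator of the half-space <u,v> < c.  Boolean combinations of half-spaces
   separate disjoint compact sets, and tightness then shows that t^-r times the
   measure vanishes on every Borel set.  No Fubini theorem is involved: on a
   nonseparable space the kernels need not be measurable for the product of the
   Borel sigma-algebras. *)

(** * Positive definite kernels *)

Section psd_kernels.
Context {R : realType} {X : Type}.
Implicit Types (K L : X -> X -> R) (s : seq (R * X)).

(** The energy of the finitely supported signed measure with mass [p.1] at [p.2]. Points may repeat
    in the list, so induction and insertion carry no side condition. *)
Definition kform K s : R :=
  \sum_(p <- s) \sum_(q <- s) p.1 * q.1 * K p.2 q.2.

Definition psd K := (forall x y, K x y = K y x) /\ forall s, 0 <= kform K s.

(** Adding a point mass gives a quadratic polynomial in its weight; [discr_le] then turns positivity
    into Cauchy-Schwarz inequalities. *)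
Lemma kform_cons K p s : (forall x y, K x y = K y x) ->
  kform K (p :: s) = kform K s +
    2 * p.1 * (\sum_(q <- s) q.1 * K q.2 p.2) + p.1 ^+ 2 * K p.2 p.2.
Proof.
move=> Ksym; rewrite /kform big_cons big_cons.
under [in X in _ + X = _]eq_bigr do rewrite big_cons.
rewrite big_split /=.
have -> : \sum_(j <- s) p.1 * j.1 * K p.2 j.2 =
    p.1 * \sum_(q <- s) q.1 * K q.2 p.2.
  by rewrite mulr_sumr; apply: eq_bigr => q _; rewrite Ksym; ring.
have -> : \sum_(i <- s) i.1 * p.1 * K i.2 p.2 =
    p.1 * \sum_(q <- s) q.1 * K q.2 p.2.
  by rewrite mulr_sumr; apply: eq_bigr => q _; ring.
by ring.
Qed.

Lemma kform_map K (g : X -> R) s :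
  kform K [seq (p.1 * g p.2, p.2) | p <- s] =
  kform (fun x y => g x * g y * K x y) s.
Proof.
rewrite /kform big_map; apply: eq_bigr => p _.
by rewrite big_map; apply: eq_bigr => q _ /=; ring.
Qed.

Lemma psdD K L : psd K -> psd L -> psd (fun x y => K x y + L x y).
Proof.
move=> [Ks K0] [Ls L0]; split=> [x y|s]; first by rewrite Ks Ls.
have -> : kform (fun x y => K x y + L x y) s = kform K s + kform L s.
  rewrite /kform -big_split; apply: eq_bigr => p _.
  by rewrite -big_split; apply: eq_bigr => q _; rewrite mulrDr.
exact: addr_ge0.
Qed.

Lemma psd_conj (g : X -> R) K : psd K -> psd (fun x y => g x * g y * K x y).
Proof.
move=> [Ks K0]; split=> [x y|s]; first by rewrite Ks (mulrC (g x)).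
by rewrite -kform_map K0.
Qed.

Lemma psdZ (c : R) K : 0 <= c -> psd K -> psd (fun x y => c * K x y).
Proof.
move=> c0 psdK; have := psd_conj (fun=> Num.sqrt c) psdK.
by rewrite -expr2 sqr_sqrtr.
Qed.

Lemma psd1 : psd (fun _ _ => 1).
Proof.
split=> // s; have -> : kform (fun _ _ => 1) s = (\sum_(p <- s) p.1) ^+ 2.
  rewrite expr2 mulr_suml /kform; apply: eq_bigr => p _.
  by rewrite mulr_sumr; apply: eq_bigr => q _; rewrite mulr1.
exact: sqr_ge0.
Qed.

Lemma psd0 : psd (fun _ _ => 0).
Proof. by have := psdZ (lexx 0) psd1; under eq_fun do rewrite mul0r. Qed.

Lemma psd_sum (K : nat -> X -> X -> R) n : (forall k, psd (K k)) ->
  psd (fun x y => \sum_(k < n) K k x y).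
Proof.
move=> psdK; elim: n => [|n IH].
  by under eq_fun do under eq_fun do rewrite big_ord0; exact: psd0.
under eq_fun do under eq_fun do rewrite big_ord_recr/=.
exact: psdD.
Qed.

Lemma psd_cvg (K_ : nat -> X -> X -> R) K : (forall n, psd (K_ n)) ->
  (forall x y, K_ n x y @[n --> \oo] --> K x y) -> psd K.
Proof.
move=> psdK KK; split=> [x y|s].
  have -> : K x y = limn (fun n => K_ n x y) by apply/esym/cvg_lim => //; exact: KK.
  have -> : (fun n => K_ n x y) = (fun n => K_ n y x).
    by apply/funext => n; rewrite (psdK n).1.
  by apply: cvg_lim => //; exact: KK.
have : kform (K_ n) s @[n --> \oo] --> kform K s.
  apply: cvg_big => [|p _]; first exact: add_continuous.
  apply: cvg_big => [|q _]; first exact: add_continuous.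
  by apply: cvgM; [exact: cvg_cst|exact: KK].
move=> cK; rewrite -(cvg_lim (@Rhausdorff R) cK).
apply: limr_ge; first by apply/cvg_ex; exists (kform K s).
by near=> n; exact: (psdK n).2.
Unshelve. all: by end_near. Qed.

(** Cauchy-Schwarz for the form of [K] between the measures [delta_x - delta_x'] and [delta_y]. When
    the diagonal is bounded, it controls the variation of [K x y] in [x] uniformly in [y]. *)
Lemma psd_diff_le K x x' y : psd K -> (K x y - K x' y) ^+ 2 <=
  (K x x + K x' x' - 2 * K x x') * K y y.
Proof.
move=> [Ks K0]; apply: discr_le => [|s].
  have := K0 [:: (1, y)]; rewrite kform_cons// /kform !big_nil/=.
  by congr (_ <= _); ring.
have := K0 [:: (s, y); (1, x); (-1, x')].
rewrite kform_cons// kform_cons// kform_cons// /kform !(big_cons, big_nil)/=.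
by congr (_ <= _); rewrite (Ks x' x); ring.
Qed.

Lemma psd_diag_ge0 K x : psd K -> 0 <= K x x.
Proof.
move=> [Ks K0]; have := K0 [:: (1, x)]; rewrite kform_cons// /kform !big_nil/=.
by congr (_ <= _); ring.
Qed.

Lemma psd_CS K x y : psd K -> K x y ^+ 2 <= K x x * K y y.
Proof.
move=> pK; have [Ks K0] := pK.
apply: discr_le => [|s]; first exact: psd_diag_ge0.
have := K0 [:: (s, y); (1, x)].
rewrite kform_cons// kform_cons// /kform !(big_cons, big_nil)/=.
by congr (_ <= _); ring.
Qed.

(* The Schur complement of [K] at [x]; it equals [K] when [K x x = 0], since
   division by 0 gives 0. *)
Lemma psd_schur_compl K x : psd K ->
  psd (fun y z => K y z - K y x * K z x / K x x).
Proof.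
move=> pK; have [Ks K0] := pK.
split=> [y z|s]; first by rewrite Ks; congr (_ - _); ring.
set b := \sum_(q <- s) q.1 * K q.2 x.
have -> : kform (fun y z => K y z - K y x * K z x / K x x) s =
    kform K s - b ^+ 2 / K x x.
  rewrite /kform [in RHS]/b expr2 !mulr_suml -sumrB; apply: eq_bigr => p _.
  by rewrite mulr_sumr mulr_suml -sumrB; apply: eq_bigr => q _; ring.
have [k0|k0] := eqVneq (K x x) 0; first by rewrite k0 invr0 mulr0 subr0.
have := K0 ((- b / K x x, x) :: s); rewrite kform_cons//= -/b.
by congr (_ <= _); field.
Qed.

(* Schur product theorem, by splitting off one rank-one Schur complement of [K]
   at a time. *)
Lemma psdM K L : psd K -> psd L -> psd (fun x y => K x y * L x y).
Proof.
move=> pK pL; have [Ks _] := pK; have [Ls L0] := pL.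
split=> [x y|s]; first by rewrite Ks Ls.
elim: s => [|[c x] s IH] in K pK {Ks} *; first by rewrite /kform big_nil.
have [Ks _] := pK.
pose K' y z := K y z - K y x * K z x / K x x.
have pK' : psd K' := psd_schur_compl x pK.
(* By Cauchy-Schwarz a zero diagonal entry kills its whole column, so the convention [0^-1 = 0] is
   harmless. *)
have Kx0 y : K x x = 0 -> K y x = 0.
  move=> k0; have := psd_CS y x pK; rewrite k0 mulr0 => k1.
  by apply/eqP; rewrite -sqrf_eq0 eq_le k1 sqr_ge0.
have K'x y : K' y x = 0.
  rewrite /K'; have [k0|k0] := eqVneq (K x x) 0.
    by rewrite k0 invr0 mulr0 subr0 Kx0.
  by field.
(* The rank-one part of [K] only rescales the weights in the form of [L]. In the remaining form,
   [K'] vanishes in the column of [x], so the head entry drops out and the induction hypothesis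
   applies to [K'] on [s]. *)
have -> : kform (fun y z => K y z * L y z) ((c, x) :: s) =
    kform L [seq (p.1 * K p.2 x, p.2) | p <- (c, x) :: s] / K x x +
    kform (fun y z => K' y z * L y z) ((c, x) :: s).
  rewrite (kform_map L (K ^~ x)) /kform mulr_suml -big_split/=.
  apply: eq_bigr => p _; rewrite mulr_suml -big_split/=.
  by apply: eq_bigr => q _; rewrite /K'; ring.
apply: addr_ge0; first by rewrite divr_ge0 ?L0// psd_diag_ge0.
rewrite kform_cons/=; last by move=> y z; rewrite pK'.1 Ls.
rewrite K'x mul0r mulr0 addr0 big1 ?mulr0 ?addr0 ?IH//.
by move=> q _; rewrite K'x mul0r mulr0.
Qed.

Lemma psdX K n : psd K -> psd (fun x y => K x y ^+ n).
Proof.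
move=> pK; elim: n => [|n IH]; first exact: psd1.
by under eq_fun do under eq_fun do rewrite exprS; exact: psdM.
Qed.

End psd_kernels.

(** * Integration of bounded functions against differences of measures *)

Section signed_integral.
Context d (T : measurableType d) (R : realType).
Implicit Types (mu p q : {finite_measure set T -> \bar R}) (f g : T -> R).

Definition bmf f := measurable_fun setT f /\ exists M : R, forall x, `|f x| <= M.

Lemma bmf_cst c : bmf (cst c).
Proof. by split; [exact: measurable_cst|exists `|c|]. Qed.

Lemma bmfD f g : bmf f -> bmf g -> bmf (fun x => f x + g x).
Proof.
move=> [mf [M fM]] [mg [N gN]]; split; first exact: measurable_funD.
by exists (M + N) => x; rewrite (le_trans (ler_normD _ _))// lerD.
Qed.

Lemma bmfM f g : bmf f -> bmf g -> bmf (fun x => f x * g x).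
Proof.
move=> [mf [M fM]] [mg [N gN]]; split; first exact: measurable_funM.
by exists (M * N) => x; rewrite normrM ler_pM.
Qed.

Lemma bmfZ c f : bmf f -> bmf (fun x => c * f x).
Proof. by move=> bf; apply: bmfM => //; exact: bmf_cst. Qed.

Lemma bmf_indic (A : set T) : measurable A -> bmf (\1_A : T -> R).
Proof.
move=> mA; split; first exact: measurable_indic.
by exists 1 => x; rewrite indicE; case: (_ \in _); rewrite ?normr1 ?normr0.
Qed.

Lemma bmf_integrable mu f : bmf f -> mu.-integrable setT (EFin \o f).
Proof.
move=> [mf [M fM]]; apply: measurable_bounded_integrable => //.
  by rewrite -ge0_fin_numE// fin_num_measure.
exists M; split; first exact: num_real.
by move=> x Mx y _ /=; rewrite (le_trans (fM y))// ltW.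
Qed.

Definition sint p q f : R := Rintegral p setT f - Rintegral q setT f.

Lemma sintD p q f g : bmf f -> bmf g ->
  sint p q (fun x => f x + g x) = sint p q f + sint p q g.
Proof.
move=> bf bg; rewrite /sint !RintegralD//; try exact: bmf_integrable.
by ring.
Qed.

Lemma sintZ p q c f : bmf f -> sint p q (fun x => c * f x) = c * sint p q f.
Proof.
move=> bf; rewrite /sint !RintegralZl//; try exact: bmf_integrable.
by ring.
Qed.

Lemma sintB p q f g : bmf f -> bmf g ->
  sint p q (fun x => f x - g x) = sint p q f - sint p q g.
Proof.
move=> bf bg; rewrite -[in RHS]mulN1r -sintZ// -sintD//; last exact: bmfZ.
by congr sint; apply/funext => x; rewrite mulN1r.
Qed.

Lemma sint_sum p q (I : Type) (s : seq I) (F : I -> T -> R) :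
  (forall i, bmf (F i)) ->
  bmf (fun x => \sum_(i <- s) F i x) /\
  sint p q (fun x => \sum_(i <- s) F i x) = \sum_(i <- s) sint p q (F i).
Proof.
move=> bF; elim: s => [|i s [IH1 IH2]].
  under [fun x => _]eq_fun do rewrite big_nil.
  split; first exact: bmf_cst.
  rewrite big_nil -[RHS](mul0r (sint p q (cst 0))) -sintZ; last exact: bmf_cst.
  by congr sint; apply/funext => x; rewrite mul0r.
under [fun x => _]eq_fun do rewrite big_cons.
by split; [exact: bmfD|rewrite big_cons sintD// IH2].
Qed.

Definition mass p q : R := fine (p setT) + fine (q setT).

Lemma mass_ge0 p q : 0 <= mass p q.
Proof. by rewrite addr_ge0// fine_ge0. Qed.

Lemma Rintegral_indic mu A : measurable A -> Rintegral mu setT \1_A = fine (mu A).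
Proof. by move=> mA; rewrite /Rintegral integral_indic// setIT. Qed.

Lemma Rintegral_small mu f (C : set T) e M : bmf f -> measurable C ->
  (forall x, C x -> `|f x| <= e) -> (forall x, `|f x| <= M) -> 0 <= e ->
  `|Rintegral mu setT f| <= e * fine (mu setT) + M * fine (mu (~` C)).
Proof.
move=> bf mC fe fM e0; apply: (le_trans (le_normr_Rintegral _ _)) => //.
  exact: bmf_integrable.
have bC : bmf (\1_(~` C) : T -> R) by apply: bmf_indic; exact: measurableC.
have b1 : bmf (\1_setT : T -> R) by apply: bmf_indic.
rewrite -!Rintegral_indic//; last exact: measurableC.
rewrite -!RintegralZl//; try exact: bmf_integrable.
rewrite -RintegralD//; try by apply: bmf_integrable; exact: bmfZ.
apply: le_Rintegral => //.
- apply: bmf_integrable; case: bf => mf [N fN]; split.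
    exact: measurableT_comp.
  by exists N => x; rewrite normr_id.
- by apply: bmf_integrable; apply: bmfD; exact: bmfZ.
- move=> x _; rewrite in_setT mulr1.
  have [Cx|Cx] := pselect (C x).
    by rewrite memNset ?mulr0 ?addr0 ?fe//; exact/not_notE.
  by rewrite mem_set// mulr1 (le_trans (fM x))// lerDr.
Qed.

Lemma sint_small p q f (C : set T) e M dl : bmf f -> measurable C ->
  (forall x, C x -> `|f x| <= e) -> (forall x, `|f x| <= M) -> 0 <= e ->
  0 <= M -> fine (p (~` C)) <= dl -> fine (q (~` C)) <= dl ->
  `|sint p q f| <= e * mass p q + M * (dl * 2).
Proof.
move=> bf mC fe fM e0 M0 pC qC; rewrite (le_trans (ler_normB _ _))//.
have := Rintegral_small p bf mC fe fM e0.
have := Rintegral_small q bf mC fe fM e0.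
have := ler_wpM2l M0 pC; have := ler_wpM2l M0 qC.
by rewrite /mass; lra.
Qed.

Lemma sint_le p q f M : bmf f -> 0 <= M -> (forall x, `|f x| <= M) ->
  `|sint p q f| <= M * mass p q.
Proof.
move=> bf M0 fM; have := @sint_small p q f setT M M 0 bf measurableT.
rewrite mul0r mulr0 addr0 setCT !measure0; apply => //.
Qed.

Lemma sint_cvg p q (f_ : nat -> T -> R) f M :
  (forall n, measurable_fun setT (f_ n)) -> (forall n x, `|f_ n x| <= M) ->
  (forall x, f_ n x @[n --> \oo] --> f x) ->
  bmf f /\ sint p q (f_ n) @[n --> \oo] --> sint p q f.
Proof.
move=> mf fM ff.
have mf0 : measurable_fun setT f by apply: measurable_fun_cvg => // x _; exact: ff.
split.
  split=> //; exists M => x.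
  have c : `|f_ n x| @[n --> \oo] --> `|f x| by apply: cvg_norm; exact: ff.
  rewrite -(cvg_lim (@Rhausdorff R) c); apply: limr_le.
    by apply/cvg_ex; exists `|f x|.
  by near=> n.
have key mu : Rintegral mu setT (f_ n) @[n --> \oo] --> Rintegral mu setT f.
  have [] := @dominated_convergence _ _ _ mu setT measurableT
    (fun n => EFin \o f_ n) (EFin \o f) (EFin \o cst M).
  - by move=> n; exact/measurable_EFinP.
  - exact/measurable_EFinP.
  - by apply: aeW => x _; apply: cvg_EFin; [near=> n|exact: ff].
  - by apply: bmf_integrable; exact: bmf_cst.
  - by apply: aeW => x n _; rewrite /= lee_fin.
  move=> fint _ c; apply: fine_cvg.
  have -> : ((fine (\int[mu]_x (EFin \o f) x))%:E = \int[mu]_x (EFin \o f) x)%E.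
    by apply: fineK; exact: integrable_fin_num.
  exact: c.
by apply: cvgB; exact: key.
Unshelve. all: by end_near. Qed.

End signed_integral.

(** * Energy of tight signed measures *)

(** The sets [B] for which [P] holds on [K] minus [B] form a filter, proper if [P K] failed. By
    compactness it would then cluster at a point of [K], against the local hypothesis there. *)
Lemma compact_induction (X : topologicalType) (P : set X -> Prop) (K : set X) :
  compact K -> P set0 -> (forall A B, A `<=` B -> P B -> P A) ->
  (forall A B, P A -> P B -> P (A `|` B)) ->
  (forall x, K x -> exists2 B, nbhs x B & P B) -> P K.
Proof.
move=> cK P0 Psub PU Ploc; apply: contrapT => nPK.
pose F : set_system X := [set B | P (K `\` B)].
have FF : ProperFilter F.
  apply: Build_ProperFilter; first by rewrite /F /= setD0.
  split=> [|A B FA FB|A B AB FA]; rewrite /F/=.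
  - by rewrite setDT.
  - by rewrite setDIr; exact: PU.
  - by apply: Psub FA; exact: setDS.
have [|x [Kx Fx]] := cK F FF; first by rewrite /F /= setDv.
have [B xB PB] := Ploc _ Kx.
have : F (~` B) by apply: Psub PB => y [_ /contrapT].
by move=> /Fx /(_ xB) [y [/(_ _)]].
Qed.

Lemma continuous_borel (R : realType) (X : ptopologicalType) (f : X -> R) :
  continuous f -> measurable_fun (setT : set (borelType X)) f.
Proof.
move=> /continuousP cf; apply: (measurability _ (RGenOpens.measurableE R)).
move=> _ [_ [a [b ->] <-]]; rewrite setTI; apply: sub_sigma_algebra.
exact/cf/interval_open.
Qed.

Section kernel_integrals.
Context {R : realType} {X : ptopologicalType} (hX : hausdorff_space X).
Local Notation T := (borelType X).
Context (p q : {finite_measure set T -> \bar R}).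
Implicit Types (K : X -> X -> R).

(** The form in which the Radon property is used: discretization needs it on the whole space,
    uniqueness inside arbitrary Borel sets. *)
Definition tight := forall E : set T, measurable E ->
  forall e : R, 0 < e -> exists C : set X, [/\ compact C, C `<=` E,
    fine (p (E `\` C)) <= e & fine (q (E `\` C)) <= e].

Lemma compact_borel (C : set X) : compact C -> measurable (C : set T).
Proof.
move=> /(compact_closed hX) cC; rewrite -[C]setCK; apply: measurableC.
by apply: sub_sigma_algebra; exact: closed_openC.
Qed.

(** A finite-valued quantization of the space; composing with it turns integrals into finite
    sums. *)
Fixpoint pick_center (O : X -> set X) (z0 : X) (l : seq X) (x : X) : X :=
  if l is z :: l' then if x \in O z then z else pick_center O z0 l' x else z0.

Lemma pick_centerP O z0 l x : (exists2 z, List.In z l & O z x) ->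
  O (pick_center O z0 l x) x.
Proof.
elim: l => [[]//|z l IH [w /= + Owx]]; case: ifPn => [|xz []]; first by rewrite inE.
  by move=> wz; move: xz; rewrite wz mem_set.
by move=> wl; apply: IH; exists w.
Qed.

(** The atoms [s] do not depend on [g]: their weights are the signed masses of the cells in [B]. The
    induction removes from [B] the cell already treated. *)
Lemma sint_pick_center O z0 l (B : set T) :
  (forall z, measurable (O z : set T)) -> measurable B ->
  exists s : seq (R * X), forall g : X -> R,
    bmf (fun x : T => \1_B x * g (pick_center O z0 l x)) /\
    sint p q (fun x => \1_B x * g (pick_center O z0 l x)) =
      \sum_(w <- s) w.1 * g w.2.
Proof.
move=> mO; elim: l => [|z l IH] in B * => mB /=.
  exists [:: (sint p q \1_B, z0)] => g; rewrite big_seq1/=.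
  rewrite (_ : (fun x => _) = (fun x => g z0 * \1_B x)); last first.
    by apply/funext => x; rewrite mulrC.
  rewrite sintZ; last exact: bmf_indic.
  by rewrite mulrC; split=> //; apply: bmfZ; exact: bmf_indic.
have [s Hs] := IH (B `\` O z) (measurableD mB (mO z)).
exists ((sint p q \1_(B `&` O z), z) :: s) => g; rewrite big_cons/=.
have [bg <-] := Hs g.
have bBO : bmf (\1_(B `&` O z) : T -> R) by apply: bmf_indic; exact: measurableI.
rewrite (_ : (fun x => _) = (fun x => g z * \1_(B `&` O z) x +
    \1_(B `\` O z) x * g (pick_center O z0 l x))); last first.
  apply/funext => x; rewrite !indicE in_setI in_setD.
  by case: (x \in B); case: (x \in O z); rewrite /=; ring.
rewrite sintD// ?sintZ//; last exact: bmfZ.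
by rewrite mulrC; split=> //; apply: bmfD => //; exact: bmfZ.
Qed.

(** Only separate continuity and data on the diagonal are required; Cauchy-Schwarz upgrades them to
    boundedness and equicontinuity. *)
Definition regular_kernel K := [/\ psd K, exists M, forall x, K x x <= M,
  forall x, continuous (K x) & continuous (fun x => K x x)].

Section regular.
Context K (nK : regular_kernel K).

Lemma regular_bounded : exists2 M, 0 <= M & forall x y, `|K x y| <= M.
Proof.
have [pK [M KM] _ _] := nK.
have M0 : 0 <= M by apply: le_trans (KM point); exact: psd_diag_ge0.
exists M => // x y; rewrite -(@ler_pXn2r _ 2)// ?nnegrE//.
rewrite real_normK ?num_real//; apply: (le_trans (psd_CS x y pK)).
by rewrite expr2 ler_pM// psd_diag_ge0.
Qed.

(** In [psd_diff_le] the factor [K x x + K x' x' - 2 * K x x'] tends to 0 as [x'] tends to [x],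
    while [K y y] stays bounded. *)
Lemma regular_equicont (x : X) e : 0 < e ->
  \forall x' \near x, forall y, `|K x y - K x' y| <= e.
Proof.
move=> e0; have [pK [M KM] cK cD] := nK.
have M0 : 0 <= M by apply: le_trans (KM point); exact: psd_diag_ge0.
have c : (K x x + K x' x' - 2 * K x x') * M @[x' --> x] --> 0.
  rewrite [X in _ --> X](_ : _ = (K x x + K x x - 2 * K x x) * M); last by ring.
  apply: cvgMl; apply: cvgB.
    by apply: cvgD; [exact: cvg_cst|exact: cD].
  by apply: cvgM; [exact: cvg_cst|exact: cK].
have e2 : 0 < e ^+ 2 by rewrite exprn_gt0.
move/cvgr0Pnorm_le : c => /(_ _ e2); apply: filterS => x' h y.
rewrite -(@ler_pXn2r _ 2)// ?nnegrE// ?(ltW e0)//.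
rewrite real_normK ?num_real//; apply: (le_trans (psd_diff_le x x' y pK)).
apply: le_trans h; apply: le_trans (ler_norm _).
apply: ler_wpM2l => //.
have := pK.2 [:: (1, x); (-1, x')].
rewrite !(kform_cons _ _ pK.1) /kform !(big_cons, big_nil)/=.
by rewrite (pK.1 x' x); congr (_ <= _); ring.
Qed.

Lemma regular_bmf y : bmf (fun x : T => K x y).
Proof.
have [pK _ cK _] := nK; split.
  apply: continuous_borel; rewrite (_ : (fun x => K x y) = K y)//.
  by apply/funext => x; rewrite pK.1.
by have [M _ KM] := regular_bounded; exists M => x; exact: KM.
Qed.

(** Equicontinuity makes the potential continuous, so the outer integral of the energy is that of a
    bounded Borel function. *)
Lemma regular_bmf_sint : bmf (fun y : T => sint p q (fun x => K x y)).
Proof.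
have [pK _ _ _] := nK; have [M M0 KM] := regular_bounded; split; last first.
  exists (M * mass p q) => y; apply: sint_le => //; exact: regular_bmf.
apply: continuous_borel => y; apply/cvgrPdist_le => e e0.
have e1 : 0 < e / (mass p q + 1).
  by rewrite divr_gt0// ltr_wpDl// mass_ge0.
move: (regular_equicont y e1); apply: filterS => y' h.
rewrite -sintB; try exact: regular_bmf.
apply: (@le_trans _ _ (e / (mass p q + 1) * mass p q)).
  apply: sint_le; rewrite ?(ltW e1)//.
    have := bmfD (regular_bmf y) (bmfZ (-1) (regular_bmf y')).
    by congr bmf; apply/funext => x; rewrite mulN1r.
  by move=> x; rewrite !(pK.1 x).
rewrite mulrAC ler_pdivrMr ?ltr_wpDl ?mass_ge0//.
by rewrite ler_wpM2l ?(ltW e0)// lerDl.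
Qed.

(** Finitely many cells on which [K] hardly depends on its first variable cover a compact set
    carrying almost all the mass; each cell is collapsed to a centre. This transfers positivity from
    finite forms to integrals. *)
Lemma regular_discretization : tight -> forall eta, 0 < eta ->
  exists s : seq (R * X),
    (forall y, `|sint p q (fun x => K x y) - \sum_(w <- s) w.1 * K w.2 y| <= eta)
    /\ `|sint p q (fun y => sint p q (fun x => K x y)) - kform K s| <= eta.
Proof.
move=> tpq eta eta0; have [pK _ cK _] := nK; have [M M0 KM] := regular_bounded.
set m := mass p q; have m0 : 0 <= m := mass_ge0 p q.
(* The energy error is a sum of two terms bounded by [e1 * m], whence this value. Half of [e1] is
   spent on the compact set through [e], half off it through [dl]. *)
pose e1 := eta / (2 * m + 1).
have e10 : 0 < e1 by rewrite divr_gt0//; lra.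
pose e := e1 / (2 * (m + 1)).
have e0 : 0 < e by rewrite divr_gt0//; lra.
pose dl := e1 / (8 * (M + 1)).
have dl0 : 0 < dl by rewrite divr_gt0//; lra.
have small : e * m + (2 * M) * (dl * 2) <= e1.
  have : e * m <= e1 / 2.
    rewrite /e (_ : e1 / 2 = e1 / (2 * (m + 1)) * (m + 1)); last by field; lra.
    by apply: ler_wpM2l; [exact: ltW|lra].
  have : 2 * M * (dl * 2) <= e1 / 2.
    rewrite (_ : e1 / 2 = 2 * (M + 1) * (dl * 2)); last by rewrite /dl; field; lra.
    by rewrite ler_wpM2r//; [rewrite mulr_ge0//; exact: ltW|lra].
  by lra.
have [C [cC _ pC qC]] := tpq setT measurableT dl dl0.
have mC := compact_borel cC.
(* Taking the interior makes each cell open, hence Borel; it still contains [z] by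
   equicontinuity. *)
pose O z := interior [set x | forall y, `|K x y - K z y| <= e].
have mO z : measurable (O z : set T).
  by apply: sub_sigma_algebra; exact: open_interior.
have [l Cl] : exists l : seq X, forall x, C x -> exists2 z, List.In z l & O z x.
  apply: (@compact_induction X
    (fun B => exists l : seq X, forall x, B x ->
      exists2 z, List.In z l & O z x)) => //.
  - by exists [::].
  - by move=> A B AB [l Bl]; exists l => x /AB /Bl.
  - move=> A B [l Al] [l' Bl]; exists (l ++ l') => x.
    case=> [/Al|/Bl] [z zl Oz]; exists z => //; apply/List.in_app_iff.
      by left.
    by right.
  - move=> x Cx; exists (O x).
      apply: open_nbhs_nbhs; split; first exact: open_interior.
      have := regular_equicont x e0; apply: filterS => x' + y => /(_ y).
      by rewrite distrC.
    by exists [:: x] => y Oy; exists x => //; left.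
pose phi := pick_center O point l.
have [s Hs] := sint_pick_center point l mO measurableT.
have phiE (g : X -> R) : bmf (fun x : T => g (phi x)) /\
    sint p q (fun x => g (phi x)) = \sum_(w <- s) w.1 * g w.2.
  have := Hs g; rewrite (_ : (fun x => _) = (fun x : T => g (phi x)))//.
  by apply/funext => x; rewrite indicT mul1r.
have bd y : `|sint p q (fun x => K x y) - \sum_(w <- s) w.1 * K w.2 y| <= e1.
  have [b1 <-] := phiE (K ^~ y); rewrite -sintB//; last exact: regular_bmf.
  apply: le_trans small; apply: (@sint_small _ T _ p q _ C e (2 * M) dl) => //.
  - have := bmfD (regular_bmf y) (bmfZ (-1) b1).
    by congr bmf; apply/funext => x; rewrite mulN1r.
  - move=> x /Cl /(pick_centerP point) /interior_subset; exact.
  - move=> x; rewrite (le_trans (ler_normB _ _))//.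
    by have := KM x y; have := KM (phi x) y; lra.
  - exact: ltW.
  - by rewrite mulr_ge0.
  - by rewrite -setTD.
  - by rewrite -setTD.
have e1eta : 2 * (e1 * m) <= eta.
  rewrite /e1 (_ : 2 * _ = eta * ((2 * m) / (2 * m + 1))); last by field; lra.
  by rewrite ler_piMr ?(ltW eta0)// ler_pdivrMr; lra.
have e1eta' : e1 <= eta.
  by rewrite /e1 ler_pdivrMr; last lra; rewrite ler_peMr ?(ltW eta0)//; lra.
exists s; split=> [y|]; first exact: le_trans (bd y) _.
set F := fun y => sint p q (fun x => K x y).
pose H y := \sum_(w <- s) w.1 * K w.2 y.
have bK (w : R * X) : bmf (fun y : T => w.1 * K w.2 y).
  apply: bmfZ; have := regular_bmf w.2; congr bmf.
  by apply/funext => x; rewrite pK.1.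
have [bH HE] := sint_sum p q s bK.
have kE : kform K s = \sum_(w <- s) w.1 * H w.2.
  rewrite /kform; apply: eq_bigr => w _; rewrite /H mulr_sumr.
  by apply: eq_bigr => w' _; rewrite pK.1; ring.
have bF : bmf (F : T -> R) := regular_bmf_sint.
have HE' : sint p q H = \sum_(w <- s) w.1 * F w.2.
  rewrite HE; apply: eq_bigr => w _; rewrite sintZ.
    by congr (_ * sint _ _ _); apply/funext => x; rewrite pK.1.
  have := regular_bmf w.2; congr bmf.
  by apply/funext => x; rewrite pK.1.
have bFH : bmf (fun y : T => F y - H y).
  have := bmfD bF (bmfZ (-1) bH).
  by congr bmf; apply/funext => x; rewrite mulN1r.
have s1 : `|sint p q F - sint p q H| <= e1 * m.
  rewrite -sintB//; apply: sint_le; [assumption|exact: ltW|move=> y; exact: bd].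
(* By symmetry, both terms are sums over the atoms, of [F] and of [H] respectively. Their difference
   is thus the integral of the uniformly small [F - H] composed with [phi]. *)
have s2 : `|sint p q H - kform K s| <= e1 * m.
  have [b2 E2] := phiE (fun y => F y - H y).
  rewrite kE HE' -sumrB.
  under eq_bigr do rewrite -mulrBr.
  by rewrite -E2; apply: sint_le; [assumption|exact: ltW|move=> y; exact: bd].
rewrite (_ : _ - _ =
  (sint p q F - sint p q H) + (sint p q H - kform K s)); last by ring.
by rewrite (le_trans (ler_normD _ _))//; lra.
Qed.

(** This is the energy of [p - q] perturbed by the mass [t] at [y], a limit of the nonnegative forms
    of [(t, y) :: s]. *)
Lemma regular_delta_ge0 (y : X) (t : R) : tight ->
  0 <= sint p q (fun y => sint p q (fun x => K x y)) +
       2 * t * sint p q (fun x => K x y) + t ^+ 2 * K y y.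
Proof.
move=> tpq; have [pK _ _ _] := nK; apply/ler_addgt0Pr => eta eta0.
(* The energy error enters once and the potential error [2 * |t|] times, hence the accuracy asked of
   the discretization. *)
have t1 : 0 < 1 + 2 * `|t| by rewrite ltr_wpDr// mulr_ge0.
have [s [Fs Qs]] := regular_discretization tpq (divr_gt0 eta0 t1).
have := pK.2 ((t, y) :: s); rewrite (kform_cons _ _ pK.1)/=.
set S := \sum_(_ <- _) _ => /le_trans; apply.
move: Qs (Fs y); rewrite -/S; set F := sint p q (fun x : T => K x y).
set Q := sint p q _ => Qs Fy; set e' := eta / _ in Qs Fy.
have -> : eta = e' + 2 * (`|t| * e') by rewrite /e'; field; rewrite gt_eqF.
have : kform K s <= Q + e' by move: Qs; rewrite ler_norml => /andP[]; lra.
have : t * S <= t * F + `|t| * e'.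
  rewrite -lerBlDl -mulrBr (le_trans (ler_norm _))// normrM ler_wpM2l//.
  by rewrite distrC.
by lra.
Qed.

Lemma regular_sint_ge0 : tight ->
  0 <= sint p q (fun y => sint p q (fun x => K x y)).
Proof.
move=> tpq; have := regular_delta_ge0 point 0 tpq.
by rewrite mulr0 mul0r expr0n mul0r !addr0.
Qed.

(** A quadratic in [t] that is nonnegative and has no constant term has no linear term either. *)
Lemma regular_sint_eq0 (y : X) : tight ->
  sint p q (fun y => sint p q (fun x => K x y)) = 0 ->
  sint p q (fun x => K x y) = 0.
Proof.
move=> tpq Q0; have [pK _ _ _] := nK; apply/eqP; rewrite -sqrf_eq0 eq_le sqr_ge0.
rewrite andbT -[leRHS](mul0r (K y y)).
apply: discr_le => [|t]; first exact: psd_diag_ge0.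
by have := regular_delta_ge0 y t tpq; rewrite Q0.
Qed.

End regular.

End kernel_integrals.

(** * Exponential and binomial series *)

Section exponential_series.
Context {R : realType}.
Implicit Types (x M : R).

Lemma exp_sum_cvg x :
  \sum_(k < n) x ^+ k / k`!%:R @[n --> \oo] --> expR x.
Proof.
have := is_cvg_series_exp_coeff x; rewrite /expR.
by under [fun n => \sum_(_ < _) _]eq_fun do
  rewrite -(big_mkord xpredT (fun k => x ^+ k / k`!%:R)).
Qed.

(** The partial sums at [M] increase to [expR M]. The bound is uniform in [n], as dominated
    convergence requires. *)
Lemma exp_sum_le x M n : `|x| <= M ->
  `|\sum_(k < n) x ^+ k / k`!%:R| <= expR M.
Proof.
move=> xM; apply: (le_trans (ler_norm_sum _ _ _)).
have M0 : 0 <= M by rewrite (le_trans _ xM).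
apply: (@le_trans _ _ (\sum_(k < n) M ^+ k / k`!%:R)).
  apply: ler_sum => k _; rewrite normrM normrX [X in _ * X]ger0_norm ?invr_ge0//.
  by rewrite ler_wpM2r ?invr_ge0// lerXn2r ?nnegrE.
rewrite -(cvg_lim (@Rhausdorff R) (@exp_sum_cvg M)).
apply: (nondecreasing_cvgn_le (u_ := fun n => \sum_(k < n) M ^+ k / k`!%:R)).
  apply/nondecreasing_seqP => k; rewrite big_ord_recr/= lerDl.
  by rewrite mulr_ge0 ?invr_ge0// exprn_ge0.
by apply/cvg_ex; exists (expR M); exact: exp_sum_cvg.
Qed.

End exponential_series.

(** * The binomial series of (1 - x)^-r and its comparison with the exponential series *)

Section binomial_series.
Context {R : realType}.
Implicit Types (r x : R) (n k : nat).

(** The Taylor coefficient of (1 - x)^-r, a rising factorial of [r] divided by n!. *)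
Definition nbin r n : R := \prod_(k < n) ((r + k%:R) / k.+1%:R).

Lemma nbin0 r : nbin r 0 = 1. Proof. by rewrite /nbin big_ord0. Qed.

Lemma nbinS r n : n.+1%:R * nbin r n.+1 = (r + n%:R) * nbin r n.
Proof.
rewrite /nbin big_ord_recr/= mulrCA [n.+1%:R * _]mulrC.
by rewrite divfK ?pnatr_eq0// mulrC.
Qed.

Lemma nbin_gt0 r n : 0 < r -> 0 < nbin r n.
Proof. by move=> r0; apply: prodr_gt0 => k _; rewrite divr_gt0// ltr_pwDl. Qed.

(** Coefficientwise, the derivative of (1 - x)^-r is r (1 - x)^-(r + 1). It expresses the remainder
    below through [nbin (r + 1)]. *)
Lemma nbinS_shift r n : n.+1%:R * nbin r n.+1 = r * nbin (r + 1) n.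
Proof.
elim: n => [|n IH]; first by rewrite nbinS !nbin0 addr0.
have n0 : n.+1%:R != 0 :> R by rewrite pnatr_eq0.
apply: (mulfI n0); rewrite nbinS mulrCA IH [RHS]mulrCA nbinS.
by rewrite -!(addrA r) (addrC 1) -natr1; ring.
Qed.

Definition nbin_sum r n x : R := \sum_(k < n) nbin r k * x ^+ k.

Lemma is_derive_nbin_sum r n x : is_derive x 1 (nbin_sum r n)
  (\sum_(k < n) k%:R * nbin r k * x ^+ k.-1).
Proof.
elim: n => [|n IH].
  rewrite big_ord0 (_ : nbin_sum r 0 = cst 0); first exact: is_derive_cst.
  by apply/funext => y; rewrite /nbin_sum big_ord0.
rewrite (_ : nbin_sum r n.+1 =
    nbin_sum r n \+ (fun y => nbin r n * y ^+ n)); last first.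
  by apply/funext => y; rewrite /nbin_sum big_ord_recr.
rewrite big_ord_recr/=; apply: is_deriveD.
have D : is_derive x 1 (fun y => y ^+ n) (n%:R * x ^+ n.-1).
  apply: DeriveDef; first exact: exprn_derivable.
  by rewrite exp_derive /GRing.scale/= mulr1.
apply: (is_derive_eq (is_deriveZ (nbin r n) D)).
by rewrite /GRing.scale/=; ring.
Qed.

(* Up to the last monomial, [nbin_sum r n] solves (1 - x) f' = r f, the equation
   of (1 - x)^-r. *)
Lemma nbin_sum_ode r n x :
  (1 - x) * (\sum_(k < n) k%:R * nbin r k * x ^+ k.-1) =
  r * nbin_sum r n x - n%:R * nbin r n * x ^+ n.-1.
Proof.
elim: n => [|n IH]; first by rewrite /nbin_sum !big_ord0 !mulr0 !mul0r subr0.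
rewrite big_ord_recr/= mulrDr IH /nbin_sum big_ord_recr/= -/(nbin_sum r n x).
rewrite nbinS; case: n IH => [|n] _ /=; first by rewrite !mul0r addr0; ring.
by rewrite exprS; ring.
Qed.

Lemma is_derive_powR_onem r x : x < 1 ->
  is_derive x 1 (fun y => (1 - y) `^ r) (- (r * (1 - x) `^ (r - 1))).
Proof.
move=> x1; have x0 : 0 < 1 - x by rewrite subr_gt0.
have D := is_derive1_powR r x0.
have E : is_derive x 1 (fun y : R => 1 - y) (-1).
  apply: (is_derive_eq (is_deriveB (is_derive_cst _ _ _) (is_derive_id _ _))).
  by rewrite sub0r.
have := @is_derive1_comp _ (fun a => a `^ r) (fun y : R => 1 - y) x _ _ D E.
by rewrite mulrN1.
Qed.

(** By the product rule and [nbin_sum_ode], everything cancels except the contribution of the last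
    monomial. *)
Lemma is_derive_powR_nbin_sum r n x : x < 1 ->
  is_derive x 1 (fun y => (1 - y) `^ r * nbin_sum r n y)
    (- ((1 - x) `^ (r - 1) * (n%:R * nbin r n * x ^+ n.-1))).
Proof.
move=> x1; have x0 : 0 < 1 - x by rewrite subr_gt0.
have := is_deriveM (is_derive_powR_onem r x1) (is_derive_nbin_sum r n x).
rewrite /GRing.scale/= => D; apply: (is_derive_eq D).
have -> : (1 - x) `^ r = (1 - x) `^ (r - 1) * (1 - x).
  rewrite -[in LHS](subrK 1 r) (@powRD _ _ (r - 1) 1); last first.
    by rewrite (gt_eqF x0) implybT.
  by rewrite powRr1// ltW.
by rewrite -(mulrA _ (1 - x)) nbin_sum_ode; ring.
Qed.

(** Mean value theorem between 0 and [x] for a function equal to 1 at 0. The two conditions on [c]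
    place it between 0 and [x] for either sign of [x]. *)
Lemma powR_nbin_sum_MVT r n x : `|x| < 1 ->
  exists2 c, `|c| <= `|x| /\ 0 <= c * x &
  (1 - x) `^ r * nbin_sum r n.+1 x =
  1 - (1 - c) `^ (r - 1) * (n.+1%:R * nbin r n.+1 * c ^+ n) * x.
Proof.
move=> xlt1; have /andP[xN x1] : (-1 < x < 1) by rewrite -ltr_norml.
pose f y := (1 - y) `^ r * nbin_sum r n.+1 y.
pose df y := - ((1 - y) `^ (r - 1) * (n.+1%:R * nbin r n.+1 * y ^+ n)).
have D (y : R) : y < 1 -> is_derive y (1 : R) f (df y).
  exact: is_derive_powR_nbin_sum.
have f0 : f 0 = 1.
  rewrite /f subr0 powR1 mul1r /nbin_sum big_ord_recl/= nbin0 expr0 mulr1.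
  by rewrite big1 ?addr0// => i _; rewrite expr0n mulr0.
have cf (a b : R) : b < 1 -> {within `[a, b], continuous f}.
  move=> b1; apply: derivable_within_continuous => y; rewrite in_itv/= => /andP[_ yb].
  by have [] := D y (le_lt_trans yb b1).
have [x0|x0] := leP 0 x.
  have [y||c + E] := @MVT_segment _ f df 0 x x0; first 1 last.
  - exact: cf.
  - rewrite in_itv/= => /andP[c0 cx]; exists c.
      by rewrite !ger0_norm// mulr_ge0.
    by rewrite -/(f x) -[LHS](subrK 1) -[in LHS]f0 E ?f0 /df; ring.
  - by rewrite in_itv/= => /andP[_ yx]; exact: D (lt_trans yx x1).
have [y||c + E] := @MVT_segment _ f df x 0 (ltW x0); first 1 last.
- exact: cf.
- rewrite in_itv/= => /andP[xc c0]; exists c.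
    by rewrite !ler0_norm ?(ltW x0)// lerN2 mulr_le0// ltW.
  by rewrite -/(f x) -[LHS](subKr 1) -[X in _ - (X - _) = _]f0 E ?f0 /df; ring.
- by rewrite in_itv/= => /andP[_ yx]; exact: D (lt_trans yx ltr01).
Qed.

Lemma nbin_sum_bounded r n x : 0 < r -> 0 <= x < 1 ->
  nbin_sum r n x <= (1 - x) `^ (- r).
Proof.
move=> r0 /andP[x0 x1].
have p0 : 0 < (1 - x) `^ r by rewrite powR_gt0// subr_gt0.
rewrite powRN -(ler_pM2l p0) divff ?gt_eqF//.
case: n => [|n]; first by rewrite /nbin_sum big_ord0 mulr0.
have xn : `|x| < 1 by rewrite ger0_norm.
have [c [cx c0] ->] := powR_nbin_sum_MVT r n xn.
rewrite lerBlDr lerDl -mulrA mulr_ge0 ?powR_ge0//.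
have nb : 0 <= nbin r n.+1 by rewrite ltW// nbin_gt0.
rewrite -mulrA; apply: mulr_ge0; first exact: mulr_ge0.
move: c0; have [->|x1'] := eqVneq x 0; first by rewrite !mulr0.
have x0' : 0 < x by rewrite lt_def x1'.
by rewrite pmulr_lge0// => c0; rewrite mulr_ge0// exprn_ge0.
Qed.

Lemma nbin_term_cvg0 r x : 0 < r -> 0 <= x < 1 ->
  nbin r n * x ^+ n @[n --> \oo] --> 0.
Proof.
move=> r0 /[dup] /andP[x0 x1] x01; apply: cvg_series_cvg_0.
apply: nondecreasing_is_cvgn.
  apply/nondecreasing_seqP => n; rewrite /series/= big_nat_recr//= lerDl.
  by rewrite mulr_ge0 ?exprn_ge0// ltW// nbin_gt0.
exists ((1 - x) `^ (- r)) => _ [n _ <-].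
by rewrite /series/= big_mkord; exact: nbin_sum_bounded.
Qed.

Lemma nbin_sum_cvg r x : 0 < r -> `|x| < 1 ->
  nbin_sum r n x @[n --> \oo] --> (1 - x) `^ (- r).
Proof.
move=> r0 x1; have [xN xP] : -1 < x /\ x < 1 by apply/andP; rewrite -ltr_norml.
have p0 : 0 < (1 - x) `^ r by rewrite powR_gt0// subr_gt0.
(* The factor (1 - c)^(r - 1) is at most 2^r / (1 - |x|), because 1 - |x| <= 1 - c <= 2; the last
   factor [r] comes from [nbinS_shift]. *)
pose B := 2 `^ r * (1 - `|x|)^-1 * r.
have B0 : 0 <= B.
  by rewrite !mulr_ge0 ?powR_ge0 ?invr_ge0 ?subr_ge0 ?(ltW x1) ?(ltW r0).
have bd n : `|(1 - x) `^ r * nbin_sum r n.+1 x - 1| <=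
    B * (nbin (r + 1) n * `|x| ^+ n).
  have [c [cx c0] ->] := powR_nbin_sum_MVT r n x1.
  rewrite addrAC subrr add0r normrN !normrM normrX.
  have [cN cP] : -1 < c /\ c < 1.
    by apply/andP; rewrite -ltr_norml; exact: le_lt_trans x1.
  rewrite ger0_norm ?powR_ge0//.
  have -> : `|n.+1%:R| * `|nbin r n.+1| = r * nbin (r + 1) n.
    by rewrite -nbinS_shift -normrM ger0_norm// mulr_ge0// ltW// nbin_gt0.
  have h1 : (1 - c) `^ (r - 1) <= 2 `^ r * (1 - `|x|)^-1.
    have c10 : 0 < 1 - c by lra.
    rewrite (@powRB _ _ r 1) ?(powRr1 (ltW c10)); last first.
      by rewrite (gt_eqF c10) implybT.
    apply: ler_pM; rewrite ?powR_ge0 ?invr_ge0//; first by lra.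
      by apply: ge0_ler_powR; rewrite ?nnegrE ?(ltW r0)//; lra.
    rewrite lef_pV2 ?posrE; [|lra|lra].
    by rewrite lerB// (le_trans (ler_norm _)).
  have nb : 0 <= nbin (r + 1) n by rewrite ltW// nbin_gt0// addr_gt0.
  have h2 : `|c| ^+ n <= `|x| ^+ n by rewrite lerXn2r ?nnegrE.
  rewrite /B (_ : 2 `^ r * (1 - `|x|)^-1 * r * (nbin (r + 1) n * `|x| ^+ n) =
    2 `^ r * (1 - `|x|)^-1 * (r * nbin (r + 1) n * `|x| ^+ n)); last by ring.
  rewrite -[leLHS]mulrA ler_pM ?powR_ge0//.
    by rewrite !mulr_ge0 ?exprn_ge0// ltW.
  rewrite -[leRHS]mulr1 ler_pM ?mulr_ge0 ?exprn_ge0 ?(ltW r0) ?(ltW x1)//.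
  by rewrite ler_wpM2l// mulr_ge0// ltW.
have c1 : (1 - x) `^ r * nbin_sum r n.+1 x @[n --> \oo] --> (1 : R).
  apply/cvgrPdist_le => e e0.
  have : B * (nbin (r + 1) n * `|x| ^+ n) @[n --> \oo] --> B * 0.
    apply: cvgM; [exact: cvg_cst|apply: nbin_term_cvg0].
      by rewrite addr_gt0.
    by rewrite normr_ge0.
  rewrite mulr0 => /cvgr0Pnorm_le /(_ _ e0); apply: filterS => n h.
  rewrite distrC (le_trans (bd n))// (le_trans _ h)// ler_norm//.
rewrite -(@cvg_shiftS _ (fun n => nbin_sum r n x)).
have -> : (fun n => nbin_sum r n.+1 x) =
    (fun n => (1 - x) `^ (- r) * ((1 - x) `^ r * nbin_sum r n.+1 x)).
  by apply/funext => n; rewrite powRN mulKf// gt_eqF.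
have := cvgM (cvg_cst ((1 - x) `^ (- r))) c1; rewrite mulr1; exact.
Qed.

(** Consecutive ratios are [(r + n) / (n + 1)] for [nbin] and [sg / (n + 1)] for the exponential
    coefficients, so the inequality propagates once [n >= sg]. The constant [c] takes care of the
    finitely many earlier indices. *)
Lemma nbin_ge_exp_coeff r (sg : R) : 0 < r -> 0 < sg ->
  exists2 c, 0 < c & forall n, c * (sg ^+ n / n`!%:R) <= nbin r n.
Proof.
move=> r0 s0; pose b n : R := sg ^+ n / n`!%:R.
have b0 n : 0 < b n by rewrite divr_gt0 ?exprn_gt0// ltr0n fact_gt0.
have bS n : n.+1%:R * b n.+1 = sg * b n.
  have n1 : n.+1%:R != 0 :> R by rewrite pnatr_eq0.
  have nf : n`!%:R != 0 :> R by rewrite pnatr_eq0 -lt0n fact_gt0.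
  rewrite /b factS natrM exprS; move: (n.+1%:R) (n`!%:R) n1 nf => u v u0 v0.
  by field; rewrite u0 v0.
have initial N : exists2 c, 0 < c & forall n, (n <= N)%N -> c * b n <= nbin r n.
  elim: N => [|N [c c0 IH]].
    exists 1 => // n; rewrite leqn0 => /eqP ->.
    by rewrite /b nbin0 fact0 expr0 invr1 !mul1r.
  exists (Num.min c (nbin r N.+1 / b N.+1)).
    by rewrite lt_min c0 divr_gt0// nbin_gt0.
  move=> n; rewrite leq_eqVlt => /orP[/eqP ->|nN].
    by rewrite -ler_pdivlMr// ge_min lexx orbT.
  by apply: le_trans (IH n nN); rewrite ler_wpM2r ?ge_min ?lexx// ltW.
pose N := (Num.trunc sg).+1; have sN : sg <= N%:R by rewrite ltW// truncnS_gt.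
have [c c0 Hc] := initial N; exists c => // n.
have [nN|Nn] := leqP n N; first exact: Hc.
rewrite -(subnK (ltnW Nn)); elim: (n - N)%N => [|k IH]; first exact: Hc.
rewrite addSn -/(b _) -(@ler_pM2l _ (k + N).+1%:R)// mulrCA bS nbinS mulrCA.
apply: ler_pM => //; rewrite ?(ltW s0)//; first by rewrite mulr_ge0// ltW.
by rewrite natrD; have : 0 <= k%:R :> R by []; lra.
Qed.

End binomial_series.

(** * Kernels on the hyperbolic space *)

Section continuous_real.
Context {R : realType} {X : topologicalType}.
Implicit Types (f g : X -> R).

Lemma cont_cst (c : R) : continuous (fun _ : X => c).
Proof. by move=> z; exact: cvg_cst. Qed.

Lemma contB f g : continuous f -> continuous g -> continuous (fun z => f z - g z).
Proof. by move=> cf cg z; exact: (cvgB (cf z) (cg z)). Qed.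

Lemma contM f g : continuous f -> continuous g -> continuous (fun z => f z * g z).
Proof. by move=> cf cg z; exact: (cvgM (cf z) (cg z)). Qed.

Lemma contV f : (forall z, f z != 0) -> continuous f ->
  continuous (fun z => (f z)^-1).
Proof. by move=> f0 cf z; exact: (cvgV (f0 z) (cf z)). Qed.

Lemma cont_expR f : continuous f -> continuous (fun z => expR (f z)).
Proof.
move=> cf z; exact: (cvg_comp _ _ (cf z) (@continuous_expR R (f z))).
Qed.

Lemma cont_powR f (s : R) : (forall z, 0 < f z) -> continuous f ->
  continuous (fun z => f z `^ s).
Proof.
move=> f0 cf z; have D := is_derive1_powR s (f0 z).
have c : {for f z, continuous (fun y : R => y `^ s)}.
  by apply/differentiable_continuous/derivable1_diffP; exact: ex_derive.
exact: (cvg_comp _ _ (cf z) c).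
Qed.

End continuous_real.

Section hyperbolic_kernels.
Context {R : realType} {V : hilbertType R}.
Local Notation X := (hyperbolic V).
Implicit Types (z w : X) (v : V) (r sg : R).

(** The topology comes from the metric, so continuity is read off from [bracket] being [cosh] of the
    distance. *)
Lemma bracket_continuous w : continuous (fun z : X => bracket z w).
Proof.
have bE z : bracket z w = cosh (mdist w z).
  by rewrite hyp_mdistE hdist_sym arccoshK// bracket_ge1.
have cd : continuous (fun z : X => mdist w z).
  move=> z; apply/(@cvgrPdist_lt R R X (nbhs z) (nbhs_filter z)) => e e0.
  apply/metricType_numDomainType.nbhs_mdistP; exists e => //= z' zz'.
  have := metric_triangle w z z'; have := metric_triangle w z' z.
  move=> H1 H2; have {}zz : mdist z z' < e by [].
  move: H1 H2; rewrite (metric_sym z' z) ltr_norml.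
  by move: (mdist z z') (mdist w z) (mdist w z') zz => a b c; lra.
rewrite (_ : (fun z => _) = (@cosh R) \o (fun z : X => mdist w z)); last first.
  exact/funext.
move=> z; apply: continuous_comp; first exact: cd.
rewrite /cosh; apply: cvgMl; apply: cvgD.
  exact: continuous_expR.
by apply: continuous_comp; [exact: opp_continuous|exact: continuous_expR].
Qed.

Definition hcoord z : V := (hval z).1.
Definition htime z : R := (hval z).2.

Lemma htime_continuous : continuous htime.
Proof.
rewrite (_ : htime = fun z => bracket z point); first exact: bracket_continuous.
apply/funext => z; rewrite /bracket /mink /= innerC inner0l subr0 mulr1.
by [].
Qed.

Lemma htime_gt0 z : 0 < htime z. Proof. exact: hyp_gt0. Qed.

Lemma htime_neq0 z : htime z != 0. Proof. by rewrite gt_eqF ?htime_gt0. Qed.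

Lemma bracketE z w : bracket z w = htime z * htime w - inner (hcoord z) (hcoord w).
Proof. by []. Qed.

Lemma inner_hcoord z : inner (hcoord z) (hcoord z) = htime z ^+ 2 - 1.
Proof. by have := hyp_eq z; rewrite inner_norm -/(hcoord z) -/(htime z); lra. Qed.

Lemma htime_ge1 z : 1 <= htime z.
Proof.
have := inner_ge0 (hcoord z); rewrite inner_hcoord subr_ge0.
by rewrite -{1}(expr1n _ 2) ler_pXn2r// nnegrE ltW// htime_gt0.
Qed.

(* The inner product of the points [hcoord z / htime z] and
   [hcoord w / htime w] of the projective (Klein) ball model. *)
Definition klein z w : R := inner (hcoord z) (hcoord w) / (htime z * htime w).

Lemma bracket_klein z w : bracket z w = htime z * htime w * (1 - klein z w).
Proof.
by rewrite bracketE /klein; field; rewrite !htime_neq0.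
Qed.

Lemma kleinE z w : klein z w = 1 - bracket z w / (htime z * htime w).
Proof.
by rewrite bracketE /klein; field; rewrite !htime_neq0.
Qed.

(** Writing t for [htime], Cauchy-Schwarz bounds the squared numerator by (t_z^2 - 1)(t_w^2 - 1),
    which is below t_z^2 t_w^2. *)
Lemma klein_lt1 z w : `|klein z w| < 1.
Proof.
rewrite -(@ltr_pXn2r _ 2)// ?nnegrE// real_normK ?num_real// expr1n.
rewrite /klein expr_div_n ltr_pdivrMr; last first.
  by rewrite exprn_gt0// mulr_gt0 ?htime_gt0.
rewrite mul1r (le_lt_trans (inner_CS _ _))// !inner_hcoord exprMn.
have := htime_ge1 z; have := htime_ge1 w.
rewrite -(@ler_pXn2r _ 2)// ?nnegrE// ?(ltW (htime_gt0 _))// expr1n => w1.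
rewrite -(@ler_pXn2r _ 2)// ?nnegrE// ?(ltW (htime_gt0 _))// expr1n => z1.
by nra.
Qed.

Lemma psd_inner (Y : Type) (f : Y -> V) : psd (fun x y => inner (f x) (f y)).
Proof.
split=> [x y|s]; first exact: innerC.
have innerl (t : seq (R * Y)) u : inner (\sum_(p <- t) p.1 *: f p.2) u =
    \sum_(p <- t) p.1 * inner (f p.2) u.
  elim: t => [|p t IH]; first by rewrite !big_nil inner0l.
  by rewrite !big_cons innerDl innerZl IH.
have -> : kform (fun x y => inner (f x) (f y)) s =
    inner (\sum_(p <- s) p.1 *: f p.2) (\sum_(p <- s) p.1 *: f p.2).
  rewrite innerl /kform; apply: eq_bigr => p _.
  rewrite innerC innerl mulr_sumr; apply: eq_bigr => q _.
  by rewrite innerC; ring.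
exact: inner_ge0.
Qed.

Lemma psd_klein : psd klein.
Proof.
have := psd_conj (fun z => (htime z)^-1) (psd_inner hcoord).
congr psd; apply/funext => z; apply/funext => w.
by rewrite /klein invfM mulrC.
Qed.

Lemma psd_klein_series (a : nat -> R) (f : R -> R) : (forall n, 0 <= a n) ->
  (forall x, `|x| < 1 -> \sum_(k < n) a k * x ^+ k @[n --> \oo] --> f x) ->
  psd (fun z w => f (klein z w)).
Proof.
move=> a0 af.
apply: (@psd_cvg _ _ (fun n z w => \sum_(k < n) a k * klein z w ^+ k)).
  move=> n; apply: (@psd_sum _ _ (fun k z w => a k * klein z w ^+ k)) => k.
  by apply: psdZ => //; apply: psdX; exact: psd_klein.
by move=> z w; apply: af; exact: klein_lt1.
Qed.

Definition hweight r z : R := htime z `^ (- r).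

Definition hexp r sg z w : R :=
  hweight r z * hweight r w * expR (sg * klein z w).

Lemma hkernel_klein r z w :
  hkernel r z w = hweight r z * hweight r w * (1 - klein z w) `^ (- r).
Proof.
have := klein_lt1 z w; rewrite ltr_norml => /andP[_ k1].
rewrite /hkernel bracket_klein !powRM ?mulr_ge0 ?(ltW (htime_gt0 _))//.
by rewrite subr_ge0 ltW.
Qed.

Lemma psd_hkernel r : 0 < r -> psd (@hkernel R V r).
Proof.
move=> r0; rewrite (_ : @hkernel R V r = fun z w =>
    hweight r z * hweight r w * (1 - klein z w) `^ (- r)); last first.
  by apply/funext => z; apply/funext => w; exact: hkernel_klein.
apply/psd_conj/(@psd_klein_series (nbin r) (fun x => (1 - x) `^ (- r))).
  by move=> n; rewrite ltW// nbin_gt0.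
by move=> x x1; exact: nbin_sum_cvg.
Qed.

Lemma psd_hexp r sg : 0 <= sg -> psd (hexp r sg).
Proof.
move=> s0; apply: psd_conj.
apply: (@psd_klein_series (fun k => sg ^+ k / k`!%:R) (fun x => expR (sg * x))).
  by move=> n; rewrite divr_ge0// exprn_ge0.
move=> x _; rewrite (_ : (fun n : nat => \sum_(k < n) _) =
    (fun n => \sum_(k < n) (sg * x) ^+ k / k`!%:R)); first exact: exp_sum_cvg.
by apply/funext => n; apply: eq_bigr => k _; rewrite exprMn; ring.
Qed.

Lemma psd_hkernel_sub_hexp r sg : 0 < r -> 0 < sg ->
  exists2 c, 0 < c & psd (fun z w => hkernel r z w - c * hexp r sg z w).
Proof.
move=> r0 s0; have [c c0 cn] := nbin_ge_exp_coeff r0 s0; exists c => //.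
rewrite (_ : (fun z w => _) = (fun z w => hweight r z * hweight r w *
   ((1 - klein z w) `^ (- r) - c * expR (sg * klein z w)))); last first.
  apply/funext => z; apply/funext => w; rewrite hkernel_klein /hexp; ring.
apply/psd_conj.
apply: (@psd_klein_series (fun k => nbin r k - c * (sg ^+ k / k`!%:R))
  (fun x => (1 - x) `^ (- r) - c * expR (sg * x))).
  by move=> n; rewrite subr_ge0.
move=> x x1; rewrite (_ : (fun n : nat => \sum_(k < n) _) =
    (fun n => nbin_sum r n x - c * \sum_(k < n) (sg * x) ^+ k / k`!%:R)).
  apply: cvgB; first exact: nbin_sum_cvg.
  by apply: cvgM; [exact: cvg_cst|exact: exp_sum_cvg].
apply/funext => n; rewrite /nbin_sum mulr_sumr -sumrB; apply: eq_bigr => k _.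
by rewrite exprMn; ring.
Qed.

Lemma klein_continuous z : continuous (klein z).
Proof.
rewrite (_ : klein z = fun w => 1 - bracket w z * (htime z * htime w)^-1).
  apply: contB; first exact: cont_cst.
  apply: contM; first exact: bracket_continuous.
  apply: contV; first by move=> w; rewrite mulf_neq0 ?htime_neq0.
  by apply: contM; [exact: cont_cst|exact: htime_continuous].
by apply/funext => w; rewrite kleinE bracketC.
Qed.

Lemma klein_diag_continuous : continuous (fun z => klein z z).
Proof.
rewrite (_ : (fun z => _) = fun z => 1 - (htime z * htime z)^-1).
  apply: contB; first exact: cont_cst.
  apply: contV; first by move=> w; rewrite mulf_neq0 ?htime_neq0.
  by apply: contM; exact: htime_continuous.
by apply/funext => w; rewrite kleinE bracketxx div1r.
Qed.

Lemma hweight_continuous r : continuous (hweight r).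
Proof. by apply: cont_powR; [exact: htime_gt0|exact: htime_continuous]. Qed.

Lemma hweight_gt0 r z : 0 < hweight r z.
Proof. by rewrite powR_gt0// htime_gt0. Qed.

Lemma hweight_le1 r z : 0 < r -> hweight r z <= 1.
Proof.
move=> r0; rewrite -(powRr0 (htime z)) /hweight ler_powR ?htime_ge1//.
by rewrite oppr_le0 ltW.
Qed.

Lemma hexp_continuous r sg z : continuous (hexp r sg z).
Proof.
apply: contM.
  by apply: contM; [exact: cont_cst|exact: hweight_continuous].
by apply/cont_expR/contM; [exact: cont_cst|exact: klein_continuous].
Qed.

Lemma hexp_diag_continuous r sg : continuous (fun z => hexp r sg z z).
Proof.
apply: contM; first by apply: contM; exact: hweight_continuous.
by apply/cont_expR/contM; [exact: cont_cst|exact: klein_diag_continuous].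
Qed.

Lemma hkernel_continuous r z : continuous (hkernel r z).
Proof.
apply: cont_powR; first by move=> w; rewrite (lt_le_trans ltr01)// bracket_ge1.
rewrite (_ : bracket z = fun w => bracket w z); first exact: bracket_continuous.
by apply/funext => w'; rewrite bracketC.
Qed.

Lemma hkernelxx r z : hkernel r z z = 1.
Proof. by rewrite /hkernel bracketxx powR1. Qed.

Lemma hexp_ge0 r sg z w : 0 <= hexp r sg z w.
Proof. by rewrite !mulr_ge0 ?expR_ge0 ?ltW ?hweight_gt0. Qed.

Lemma regular_hkernel r : 0 < r -> regular_kernel (@hkernel R V r).
Proof.
move=> r0; split.
- exact: psd_hkernel.
- by exists 1 => z; rewrite hkernelxx.
- by move=> z; exact: hkernel_continuous.
- rewrite (_ : (fun z => _) = cst 1); first exact: cst_continuous.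
  by apply/funext => z; rewrite hkernelxx.
Qed.

Lemma regular_hexp r sg : 0 < r -> 0 <= sg -> regular_kernel (hexp r sg).
Proof.
move=> r0 s0; split.
- exact: psd_hexp.
- exists (expR sg) => z; rewrite /hexp -[leRHS]mul1r.
  apply: ler_pM; rewrite ?expR_ge0 ?mulr_ge0 ?(ltW (hweight_gt0 _ _))//.
    by rewrite mulr_ile1 ?hweight_le1 ?(ltW (hweight_gt0 _ _)).
  rewrite ler_expR ler_piMr// (le_trans (ler_norm _))// ltW//.
  exact: klein_lt1.
- by move=> z; exact: hexp_continuous.
- exact: hexp_diag_continuous.
Qed.

Lemma regular_hkernel_sub_hexp r sg : 0 < r -> 0 < sg ->
  exists2 c, 0 < c & regular_kernel (fun z w => hkernel r z w - c * hexp r sg z w).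
Proof.
move=> r0 s0; have [c c0 pc] := psd_hkernel_sub_hexp r0 s0; exists c => //.
split=> //.
- by exists 1 => z; rewrite hkernelxx gerBl mulr_ge0 ?hexp_ge0// ltW.
- move=> z; apply: contB; first exact: hkernel_continuous.
  by apply: contM; [exact: cont_cst|exact: hexp_continuous].
- under eq_fun do rewrite hkernelxx.
  apply: contB; first exact: cont_cst.
  by apply: contM; [exact: cont_cst|exact: hexp_diag_continuous].
Qed.

Lemma hyperbolic_point v : exists z, hcoord z = v.
Proof.
pose t := Num.sqrt (1 + `|v| ^+ 2).
have t0 : 0 < 1 + `|v| ^+ 2 by rewrite ltr_pwDl// sqr_ge0.
have h : (0 < ((v, t) : V * R).2) &&
    (((v, t) : V * R).2 ^+ 2 - `|((v, t) : V * R).1| ^+ 2 == 1).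
  by rewrite /= sqrtr_gt0 t0 sqr_sqrtr ?(ltW t0)// addrK eqxx.
by exists (Hyperbolic h).
Qed.

Definition klein_form v z : R := inner (hcoord z) v / htime z.

(** With [w] the point over [v] and [sg] its time coordinate, [expR (klein_form v z)] is the
    exponential factor of [hexp r sg z w]. Since [sg] varies with [v], a whole family of kernels
    [hexp r sg] comes into play. *)
Lemma klein_formE v : exists sg w,
  0 < sg /\ forall z, klein_form v z = sg * klein z w.
Proof.
have [w wv] := hyperbolic_point v; exists (htime w), w; split=> [|z].
  exact: htime_gt0.
by rewrite /klein_form /klein wv; field; rewrite !htime_neq0.
Qed.

Lemma klein_formD u v z : klein_form (u + v) z = klein_form u z + klein_form v z.
Proof. by rewrite /klein_form innerDr mulrDl. Qed.

Lemma klein_formZ a v z : klein_form (a *: v) z = a * klein_form v z.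
Proof. by rewrite /klein_form innerZr mulrA. Qed.

Lemma klein_form_bounded v : exists M, forall z, `|klein_form v z| <= M.
Proof.
have [sg [w [s0 E]]] := klein_formE v; exists sg => z.
by rewrite E normrM gtr0_norm// ler_piMr ?(ltW s0) ?(ltW (klein_lt1 _ _)).
Qed.

Lemma klein_form_continuous v : continuous (klein_form v).
Proof.
have [sg [w [s0 E]]] := klein_formE v.
rewrite (_ : klein_form v = fun z => sg * klein w z).
  by apply: contM; [exact: cont_cst|exact: klein_continuous].
by apply/funext => z; rewrite E psd_klein.1.
Qed.

Lemma klein_form_separates z w : z <> w ->
  exists v, klein_form v z < klein_form v w.
Proof.
move=> zw; pose u z' := (htime z')^-1 *: hcoord z'.
have uE v z' : klein_form v z' = inner (u z') v.
  by rewrite /klein_form /u innerZl mulrC.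
(* For this vector the two values differ by the squared norm of [u w - u z]. It remains to recover a
   point from its Klein image, whose norm determines the time coordinate. *)
exists (u w - u z); rewrite !uE -subr_gt0.
have subl y : inner (u w - u z) y = inner (u w) y - inner (u z) y.
  by rewrite -(scaleN1r (u z)) innerDl (innerZl (-1)) mulN1r.
rewrite -subl inner_norm exprn_gt0// normr_gt0 subr_eq0; apply/eqP => uwz; apply: zw.
have nu z' : inner (u z') (u z') = 1 - (htime z')^-2.
  by rewrite /u innerZl innerZr inner_hcoord; field; rewrite htime_neq0.
have tE : htime z = htime w.
  have := nu w; rewrite uwz nu => /(can_inj (subKr 1)).
  rewrite -!exprVn => /eqP; rewrite eqrXn2// ?invr_ge0 ?(ltW (htime_gt0 _))//.
  by move=> /eqP /invr_inj.
apply: val_inj; rewrite /= [hval z]surjective_pairing [hval w]surjective_pairing.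
rewrite -/(htime z) -/(htime w) tE; congr pair.
move: uwz; rewrite /u tE => /(congr1 (fun v => htime w *: v)).
by rewrite !scalerA divff ?htime_neq0// !scale1r.
Qed.

End hyperbolic_kernels.

(** * Uniqueness of exponential transforms *)

Section exponential_uniqueness.
Context {R : realType} {X : ptopologicalType} (hX : hausdorff_space X).
Local Notation T := (borelType X).
Context (p q : {finite_measure set T -> \bar R}) (tpq : tight p q).
Context {V : lmodType R} (l : V -> X -> R) (g : T -> R).
Hypothesis lD : forall u v x, l (u + v) x = l u x + l v x.
Hypothesis lZ : forall a v x, l (a *: v) x = a * l v x.
Hypothesis l_bounded : forall v, exists M : R, forall x, `|l v x| <= M.
Hypothesis l_continuous : forall v, continuous (l v).
Hypothesis l_separates : forall x y, x <> y -> exists v, l v x < l v y.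
Hypothesis g_bmf : bmf (g : T -> R).
Hypothesis g_annihilated : forall v, sint p q (fun x => g x * expR (l v x)) = 0.

Lemma bmf_expl v : bmf (fun x : T => expR (l v x)).
Proof.
split; first by apply: measurableT_comp => //; exact: continuous_borel.
have [M lM] := l_bounded v; exists (expR M) => x.
by rewrite ger0_norm ?expR_ge0// ler_expR (le_trans (ler_norm _)).
Qed.

Definition annihilated (h : T -> R) :=
  bmf h /\ forall v, sint p q (fun x => h x * expR (l v x)) = 0.

(** Quantifying over all annihilated functions, not just [g], is what makes multipliers closed under
    products. *)
Definition multiplier (m : T -> R) :=
  bmf m /\ forall h, annihilated h -> annihilated (fun x => h x * m x).

Lemma multiplier_cst c : multiplier (cst c).
Proof.
split=> [|h [bh h0]]; first exact: bmf_cst.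
split=> [|v]; first by apply: bmfM => //; exact: bmf_cst.
have := sintZ p q c (bmfM bh (bmf_expl v)); rewrite h0 mulr0 => <-.
by congr sint; apply/funext => x /=; ring.
Qed.

Lemma multiplierD m1 m2 : multiplier m1 -> multiplier m2 ->
  multiplier (fun x => m1 x + m2 x).
Proof.
move=> [b1 M1] [b2 M2]; split=> [|h ah]; first exact: bmfD.
have [[bh1 h1] [bh2 h2]] := (M1 _ ah, M2 _ ah).
split=> [|v]; first by apply: bmfM; [exact: ah.1|exact: bmfD].
have := sintD p q (bmfM bh1 (bmf_expl v)) (bmfM bh2 (bmf_expl v)).
rewrite h1 h2 addr0 => <-.
by congr sint; apply/funext => x /=; ring.
Qed.

Lemma multiplierM m1 m2 : multiplier m1 -> multiplier m2 ->
  multiplier (fun x => m1 x * m2 x).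
Proof.
move=> [b1 M1] [b2 M2]; split=> [|h ah]; first exact: bmfM.
rewrite (_ : (fun x => _) = (fun x => h x * m1 x * m2 x)).
  exact/M2/M1.
by apply/funext => x; rewrite mulrA.
Qed.

(** Multiplying by an exponential shifts the exponent, and annihilation is asked for all
    exponents. *)
Lemma multiplier_expl v : multiplier (fun x => expR (l v x)).
Proof.
split=> [|h [bh h0]]; first exact: bmf_expl.
split=> [|u]; first by apply: bmfM => //; exact: bmf_expl.
rewrite -(h0 (v + u)); congr sint; apply/funext => x.
by rewrite lD expRD mulrA.
Qed.

Lemma multiplier_cvg (m_ : nat -> T -> R) m M :
  (forall n, multiplier (m_ n)) -> (forall n x, `|m_ n x| <= M) ->
  (forall x, m_ n x @[n --> \oo] --> m x) -> multiplier m.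
Proof.
move=> mm mM mc.
have [bm _] := sint_cvg p q (fun n => (mm n).1.1) mM mc.
split=> // h ah; have [bh _] := ah; split=> [|v]; first exact: bmfM.
have bhv := bmfM bh (bmf_expl v); have [_ [N hN]] := bhv.
have mf n : measurable_fun setT (fun x => h x * m_ n x * expR (l v x)).
  by apply: (bmfM (bmfM bh (mm n).1) (bmf_expl v)).1.
have bd n x : `|h x * m_ n x * expR (l v x)| <= N * M.
  by rewrite mulrAC normrM ler_pM.
have cv x : h x * m_ n x * expR (l v x) @[n --> \oo] --> h x * m x * expR (l v x).
  by apply: cvgMl; apply: cvgMr; exact: mc.
have [_] := sint_cvg p q mf bd cv.
under eq_fun do rewrite (((mm _).2 _ ah).2 v).
by move=> /(cvg_lim (@Rhausdorff R)) <-; rewrite lim_cst.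
Qed.

Lemma multiplier_sum (m_ : nat -> T -> R) n : (forall k, multiplier (m_ k)) ->
  multiplier (fun x => \sum_(k < n) m_ k x).
Proof.
move=> mm; elim: n => [|n IH].
  under [fun x => _]eq_fun do rewrite big_ord0; exact: multiplier_cst.
under [fun x => _]eq_fun do rewrite big_ord_recr/=; exact: multiplierD.
Qed.

Lemma multiplierX m n : multiplier m -> multiplier (fun x => m x ^+ n).
Proof.
move=> mm; elim: n => [|n IH]; first exact: multiplier_cst.
by under [fun x => _]eq_fun do rewrite exprS; exact: multiplierM.
Qed.

Lemma multiplier_expR m : multiplier m -> multiplier (fun x => expR (m x)).
Proof.
move=> mm; have [_ [M mM]] := mm.1.
apply: (@multiplier_cvg (fun n x => \sum_(k < n) m x ^+ k / k`!%:R) _ (expR M)).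
- move=> n; apply: (@multiplier_sum (fun k x => m x ^+ k / k`!%:R)) => k.
  by apply: multiplierM; [exact: multiplierX|exact: multiplier_cst].
- by move=> n x; exact: exp_sum_le.
- by move=> x; exact: exp_sum_cvg.
Qed.

(** The exponent [n * (n * x + 1)] is eventually at most [- n] if [x < 0] and always at least [n] if
    [x >= 0]; the [+ 1] settles the case [x = 0]. *)
Lemma double_exp_cvg (x : R) :
  expR (- expR (n%:R * (n%:R * x + 1))) @[n --> \oo] --> ((x < 0)%R%:R : R).
Proof.
have hn : harmonic n @[n --> \oo] --> (0 : R) := cvg_harmonic.
have eN (n : nat) : expR (- n%:R) <= harmonic n :> R.
  by rewrite expRN lef_pV2 ?posrE ?expR_gt0// -natr1 addrC expR_ge1Dx.
have [x0|x0] := ltP x 0.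
  apply: (@squeeze_cvgr _ _ _ _ (fun n => 1 - harmonic n) (fun=> 1)); last 2 first.
  - by have := cvgB (cvg_cst (1 : R)) hn; rewrite subr0; exact.
  - exact: cvg_cst.
  near=> n; apply/andP; split; last first.
    by rewrite -expR0 ler_expR oppr_le0 expR_ge0.
  apply: (le_trans _ (expR_ge1Dx _)); rewrite lerB// (le_trans _ (eN n))//.
  rewrite ler_expR -mulrN1 ler_wpM2l// -lerBrDr -ler_ndivrMr//.
  near: n; exact: nbhs_infty_ger.
apply: (@squeeze_cvgr _ _ _ _ (fun=> 0) harmonic) => //; last exact: cvg_cst.
near=> n; apply/andP; split; first exact: expR_ge0.
apply: (le_trans _ (eN n)); rewrite ler_expR lerN2.
apply: le_trans (le_trans _ (expR_ge1Dx _)) => //.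
rewrite -[leLHS]add0r lerD// -[leLHS]mulr1 ler_wpM2l// lerDr mulr_ge0.
Unshelve. all: by end_near. Qed.

Definition mset (A : set T) := measurable A /\ multiplier \1_A.

Lemma mset_halfspace v c : mset [set x | l v x < c].
Proof.
have mA : measurable ([set x | l v x < c] : set T).
  rewrite (_ : [set x | _] = l v @^-1` `]-oo, c[); last first.
    by apply/seteqP; split => x /=; rewrite in_itv.
  rewrite -[_ @^-1` _]setTI; apply: continuous_borel => //.
split=> //.
apply: (@multiplier_cvg (fun n x =>
  expR (- expR (n%:R * (n%:R * (l v x - c) + 1)))) _ 1).
- move=> n.
  (* The inner exponential is a constant times [expR] of the linear form at n^2 [v], hence a
     multiplier. *)
  have := multiplier_expl ((n%:R * n%:R) *: v).
  move=> /(multiplierM (multiplier_cst (- expR (n%:R - n%:R * n%:R * c)))).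
  move=> /multiplier_expR; congr multiplier; apply/funext => x.
  by rewrite /= mulNr -expRD lZ; congr (expR (- expR _)); ring.
- by move=> n x; rewrite ger0_norm ?expR_ge0// -expR0 ler_expR oppr_le0 expR_ge0.
- move=> x; rewrite (_ : \1_[set y | l v y < c] x = (l v x - c < 0)%R%:R :> R).
    exact: double_exp_cvg.
  rewrite indicE subr_lt0; congr (nat_of_bool _)%:R.
  by apply/idP/idP; rewrite inE.
Qed.

Lemma msetC A : mset A -> mset (~` A).
Proof.
move=> [mA MA]; split; first exact: measurableC.
have := multiplierD (multiplier_cst 1) (multiplierM (multiplier_cst (-1)) MA).
congr multiplier; apply/funext => x /=; rewrite !indicE in_setC.
by case: (x \in A); rewrite /=; ring.
Qed.

Lemma msetI A B : mset A -> mset B -> mset (A `&` B).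
Proof.
move=> [mA MA] [mB MB]; split; first exact: measurableI.
have := multiplierM MA MB.
congr multiplier; apply/funext => x; rewrite !indicE in_setI.
by case: (x \in A); case: (x \in B); rewrite /=; ring.
Qed.

Lemma msetU A B : mset A -> mset B -> mset (A `|` B).
Proof.
by move=> mA mB; rewrite -[A `|` B]setCK setCU; apply/msetC/msetI; exact: msetC.
Qed.

Lemma mset_separates_points (x y : X) : x <> y ->
  exists A : set X, [/\ mset A, nbhs x A & nbhs y (~` A)].
Proof.
move=> /l_separates [v xy]; pose c := (l v x + l v y) / 2.
exists [set z | l v z < c]; split; first exact: mset_halfspace.
  have xc : l v x < c by rewrite /c; lra.
  exact: (cvgr_lt (l v x) (@l_continuous v x) c xc).
have cy : c < l v y by rewrite /c; lra.
have : \forall z \near y, c < l v z.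
  exact: (cvgr_gt (l v y) (@l_continuous v y) c cy).
by apply: filterS => z cz /=; apply/negP; rewrite -leNgt ltW.
Qed.

Lemma mset_separates_point_compact (x : X) K : compact K -> ~ K x ->
  exists A : set X, [/\ mset A, nbhs x A & K `<=` ~` A].
Proof.
move=> cK Kx; apply: (@compact_induction X
  (fun K' => exists A : set X, [/\ mset A, nbhs x A & K' `<=` ~` A])) => //.
- exists setT; split=> //; last exact: filterT.
  by split=> //; rewrite indicT; exact: multiplier_cst.
- by move=> B B' BB' [A [mA xA B'A]]; exists A; split=> //; exact: subset_trans B'A.
- move=> B B' [A [mA xA BA]] [A' [mA' xA' BA']].
  exists (A `&` A'); split; [exact: msetI|exact: filterI|].
  by rewrite setCI; exact: setUSS.
- move=> y Ky; have xy : x <> y by move=> xy; apply: Kx; rewrite xy.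
  have [A [mA xA yA]] := mset_separates_points xy.
  by exists (~` A) => //; exists A; split.
Qed.

Lemma mset_separates_compact C K : compact C -> compact K -> C `&` K = set0 ->
  exists A : set X, [/\ mset A, C `<=` A & K `<=` ~` A].
Proof.
move=> cC cK CK0; apply: (@compact_induction X
  (fun C' => exists A : set X, [/\ mset A, C' `<=` A & K `<=` ~` A])) => //.
- exists set0; split=> //; last by rewrite setC0.
  by split=> //; rewrite indic0; exact: multiplier_cst.
- by move=> B B' BB' [A [mA xA B'A]]; exists A; split=> //; exact: subset_trans xA.
- move=> B B' [A [mA xA BA]] [A' [mA' xA' BA']].
  exists (A `|` A'); split; [exact: msetU|exact: setUSS|].
  by rewrite setCU subsetI.
- move=> x Cx; have Kx : ~ K x.
    by move=> Kx; have : (C `&` K) x by []; rewrite CK0.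
  have [A [mA xA KA]] := mset_separates_point_compact cK Kx.
  by exists A => //; exists A; split.
Qed.

Lemma sint_mset A : mset A -> sint p q (fun x => g x * \1_A x) = 0.
Proof.
have ag : annihilated g by [].
move=> [_ [_ /(_ _ ag) [_ /(_ 0)]]].
have l0 x : l 0 x = 0 by rewrite -(scale0r 0) lZ mul0r.
by under eq_fun do rewrite l0 expR0 mulr1.
Qed.

(** Compact sets inside [E] and its complement carry nearly all the mass. A set [A] in [mset]
    separating them agrees with [E] there, and the integral over [A] vanishes. *)
Lemma exponential_uniqueness (E : set T) : measurable E ->
  sint p q (fun x => g x * \1_E x) = 0.
Proof.
move=> mE; have [_ [M gM]] := g_bmf.
have M0 : 0 <= M by apply: le_trans (gM point).
apply/eqP; rewrite -normr_le0; apply/ler_addgt0Pr => e e0; rewrite add0r.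
(* Outside the two compact sets each measure has mass at most [2 * dl], so the final bound is
   [M * (2 * dl * 2)], that is [M * (e / (M + 1))]. *)
pose dl := e / (4 * (M + 1)).
have dl0 : 0 < dl by rewrite divr_gt0//; lra.
have [C [cC CE pC qC]] := @tpq E mE dl dl0.
have [K [cK KE pK qK]] := @tpq (~` E) (measurableC mE) dl dl0.
have mC := compact_borel hX cC; have mK := compact_borel hX cK.
have CK0 : C `&` K = set0.
  by apply/seteqP; split => // x [/CE Ex /KE].
have [A [mA CA KA]] := mset_separates_compact cC cK CK0.
have bE : bmf (fun x : T => g x * \1_E x) by apply: bmfM => //; exact: bmf_indic.
have bA : bmf (fun x : T => g x * \1_A x) by apply: bmfM => //; exact: bmf_indic mA.1.
rewrite -[X in `|X|]subr0 -(sint_mset mA) -sintB//.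
have cover (mu : {finite_measure set T -> \bar R}) :
    fine (mu (E `\` C)) <= dl -> fine (mu (~` E `\` K)) <= dl ->
    fine (mu (~` (C `|` K))) <= 2 * dl.
  move=> h1 h2; rewrite (_ : ~` (C `|` K) = (E `\` C) `|` (~` E `\` K)).
    rewrite measureU ?fineD ?fin_num_measure//; try exact: measurableD.
    - by lra.
    - by apply: measurableD => //; exact: measurableC.
    - by apply: measurableD => //; exact: measurableC.
    - by apply/seteqP; split => // x [[Ex _] [/(_ Ex)]].
  apply/seteqP; split => [x CKx|x [[Ex Cx]|[Ex Kx]]].
  - have [Ex|Ex] := pselect (E x); [left|right]; split=> // Cx.
      by apply: CKx; left.
    by apply: CKx; right.
  - by case=> [//|/KE].
  - by case=> [/CE|].
apply: (@le_trans _ _ (0 * mass p q + M * (2 * dl * 2))).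
  apply: (@sint_small _ T _ p q _ (C `|` K)) => //.
  - by have := bmfD bE (bmfZ (-1) bA); congr bmf; apply/funext => x; rewrite mulN1r.
  - exact: measurableU.
  - move=> x [Cx|Kx]; rewrite !indicE.
      by rewrite !mem_set ?subrr ?normr0//; [exact: CA|exact: CE].
    by rewrite !memNset ?mulr0 ?subrr ?normr0//; [exact: KA|exact: KE].
  - move=> x; rewrite -mulrBr normrM -[leRHS]mulr1 ler_pM// !indicE.
    case: (x \in E); case: (x \in A);
      by rewrite /= ?subrr ?subr0 ?sub0r ?normrN ?normr0 ?normr1.
  - exact: cover.
  - exact: cover.
rewrite mul0r add0r (_ : 2 * dl * 2 = e / (M + 1)); last by rewrite /dl; field; lra.
by rewrite mulrCA ler_piMr ?(ltW e0)// ler_pdivrMr; lra.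
Qed.

End exponential_uniqueness.

(** * Radon complex measures *)

Section radon_variation.
Context {R : realType} {X : ptopologicalType} (hX : hausdorff_space X).
Local Notation T := (borelType X).
Implicit Types (l : @cmeasure R X) (nu : {charge set T -> \bar R}).

Lemma Re_normc_ge0 (z : R[i]) : 0 <= complex.Re `|z|.
Proof. by rewrite normc_def/= sqrtr_ge0. Qed.

Lemma normr_Re_le (z : R[i]) : `|complex.Re z| <= complex.Re `|z|.
Proof. by rewrite normc_def/= -sqrtr_sqr ler_wsqrtr// lerDl sqr_ge0. Qed.

Lemma normr_Im_le (z : R[i]) : `|complex.Im z| <= complex.Re `|z|.
Proof. by rewrite normc_def/= -sqrtr_sqr ler_wsqrtr// lerDr sqr_ge0. Qed.

(** The set [B] and the leftover complete a partition of [C] to one of [E]: this is superadditivity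
    of the variation before taking the supremum over partitions of [C]. *)
Lemma cmeasure_variation_ge_partition l (B C E : set T) (F : nat -> set T) :
  measurable B -> measurable C -> measurable E -> B `<=` E -> C `<=` E ->
  B `&` C = set0 -> (forall k, measurable (F k)) -> trivIset setT F ->
  \bigcup_k F k = C ->
  ((complex.Re `|l B|)%:E + \sum_(0 <= k <oo) (complex.Re `|l (F k)|)%:E <=
   cmeasure_variation l E)%E.
Proof.
move=> mB mC mE BE CE BC0 mF tF FC.
pose G n := match n with 0 => B | 1 => E `\` (B `|` C) | n.+2 => F n end.
have FsubC n : F n `<=` C by rewrite -FC => x Fx; exists n.
have mG n : measurable (G n).
  case: n => [|[|n]] //=; apply: measurableD => //; exact: measurableU.
have tG : trivIset setT G.
  move=> [|[|i]] [|[|j]] _ _ //= [x []].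
  - by move=> Bx [_ []]; left.
  - by move=> Bx /FsubC Cx; have : (B `&` C) x by []; rewrite BC0.
  - by move=> [_ nBC] Bx; case: nBC; left.
  - by move=> [_ nBC] /FsubC Cx; case: nBC; right.
  - by move=> /FsubC Cx Bx; have : (B `&` C) x by []; rewrite BC0.
  - by move=> /FsubC Cx [_ []]; right.
  - by move=> Fi Fj; congr (_.+2); apply: tF => //; exists x.
have GE : \bigcup_k G k = E.
  apply/seteqP; split => [x [[|[|n]] _ /=]|x Ex].
  - exact: BE.
  - by case.
  - by move=> /FsubC /CE.
  - have [Bx|nBx] := pselect (B x); first by exists 0%N.
    have [|nCx] := pselect (C x).
      by rewrite -FC => -[n _ Fx]; exists n.+2.
    by exists 1%N => //; split=> // -[].
have split2 (v : set T -> \bar R) : (forall A, 0 <= v A)%E ->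
    (v B + \sum_(0 <= k <oo) v (F k) <= \sum_(0 <= k <oo) v (G k))%E.
  move=> v0; rewrite [leRHS](nneseries_split 0 2)// add0n.
  rewrite 2?big_nat_recr//= big_geq// add0e leeD//; first by rewrite leeDl.
  rewrite -(@nneseries_addn _ (v \o G) 2)//=.
  by under [leRHS]eq_eseriesr do rewrite addn2.
apply: (@le_trans _ _ (\sum_(0 <= k <oo) (complex.Re `|l (G k)|)%:E)%E).
  apply: (split2 (fun A => (complex.Re `|l A|)%:E)) => A.
  by rewrite lee_fin Re_normc_ge0.
by apply: ereal_sup_ubound; exists G.
Qed.

Lemma cmeasure_variation_ge_add l (B C E : set T) :
  measurable B -> measurable C -> measurable E -> B `<=` E -> C `<=` E ->
  B `&` C = set0 ->
  ((complex.Re `|l B|)%:E + cmeasure_variation l C <= cmeasure_variation l E)%E.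
Proof.
move=> mB mC mE BE CE BC0; rewrite addeC -leeBrDr//.
apply: ge_ereal_sup => _ [F [mF tF FC] <-]; rewrite leeBrDr// addeC.
exact: (@cmeasure_variation_ge_partition l B C E).
Qed.

Lemma cmeasure_variation_ge l (B E : set T) : measurable B -> measurable E ->
  B `<=` E -> ((complex.Re `|l B|)%:E <= cmeasure_variation l E)%E.
Proof.
move=> mB mE BE.
have t0 : trivIset [set: nat] (fun=> set0 : set T) by apply: trivIset_set0.
have b0 : \bigcup_(k in [set: nat]) (set0 : set T) = set0 by rewrite bigcup0.
apply: le_trans (cmeasure_variation_ge_partition l mB measurable0 mE BE
  (@sub0set _ E) (setI0 B) (fun=> measurable0) t0 b0).
by rewrite leeDl// nneseries_ge0// => k _ _; rewrite lee_fin Re_normc_ge0.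
Qed.

Lemma radon_variation_fin l (E : set T) : radon l -> measurable E ->
  cmeasure_variation l E \is a fin_num.
Proof.
move=> [lfin _] mE; rewrite ge0_fin_numE; last first.
  apply: le_trans (cmeasure_variation_ge l mE mE _) => //.
  by rewrite lee_fin Re_normc_ge0.
apply: le_lt_trans lfin.
apply: le_trans (cmeasure_variation_ge_add l measurable0 mE measurableT
  (@sub0set _ _) (@subsetT _ E) (set0I E)).
by rewrite leeDr// lee_fin Re_normc_ge0.
Qed.

(** Inner regularity gives [C] with variation within [e] of that of [E]; superadditivity then leaves
    at most [e] for any part of [E] disjoint from [C]. *)
Lemma radon_inner_compact l (E : set T) (e : R) : radon l -> measurable E ->
  0 < e -> exists C : set X, [/\ compact C, C `<=` E &
    forall B : set T, measurable B -> B `<=` E `\` C -> complex.Re `|l B| <= e].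
Proof.
move=> rl mE e0; have [_ /(_ E mE) [inner _]] := rl.
have fE := radon_variation_fin rl mE.
have := fE; rewrite inner => fsup.
have [_ [C [cC CE] <-]] := ub_ereal_sup_adherent e0 fsup.
rewrite -inner => lC; exists C; split=> // B mB BEC.
have mC := compact_borel hX cC.
have BC0 : B `&` C = set0 by apply/seteqP; split=> // x [/BEC[]].
have BE : B `<=` E by move=> x /BEC[].
have := cmeasure_variation_ge_add l mB mC mE BE CE BC0.
have fC := radon_variation_fin rl mC.
move: lC; rewrite -(fineK fE) -(fineK fC) -EFinB -EFinD lte_fin lee_fin; lra.
Qed.

Definition jpos nu : {finite_measure set T -> \bar R} :=
  jordan_pos (svalP (charge_hahn nu)).
Definition jneg nu : {finite_measure set T -> \bar R} :=
  jordan_neg (svalP (charge_hahn nu)).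
Definition hahnP nu : set T := (sval (charge_hahn nu)).1.
Definition hahnN nu : set T := (sval (charge_hahn nu)).2.

Lemma charge_integralE nu f :
  charge_integral nu f = sint (jpos nu) (jneg nu) f.
Proof. by []. Qed.

Lemma measurable_hahnP nu : measurable (hahnP nu).
Proof. by have [[]] := svalP (charge_hahn nu). Qed.

Lemma measurable_hahnN nu : measurable (hahnN nu).
Proof. by have [_ []] := svalP (charge_hahn nu). Qed.

Lemma hahnPN nu : hahnP nu `&` hahnN nu = set0.
Proof. by have [] := svalP (charge_hahn nu). Qed.

Lemma jposE nu (A : set T) : measurable A -> jpos nu A = nu (A `&` hahnP nu).
Proof.
by move=> mA; rewrite /jpos/= jordan_posE cjordan_posE /crestr0 mem_set.
Qed.

Lemma jnegE nu (A : set T) : measurable A -> jneg nu A = (- nu (A `&` hahnN nu))%E.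
Proof.
by move=> mA; rewrite /jneg/= jordan_negE cjordan_negE /crestr0 mem_set.
Qed.

Lemma jordanE nu (A : set T) : measurable A -> nu A = (jpos nu A - jneg nu A)%E.
Proof.
move=> mA; rewrite (jordan_decomp (svalP (charge_hahn nu)) mA)/=.
by rewrite /cadd/= cscaleN1.
Qed.

(** Inside the two Hahn sets the Jordan parts agree with [nu] up to sign, so one compact set from
    [radon_inner_compact] controls both. The domination hypothesis covers the real and the imaginary
    part of [l]. *)
Lemma radon_tight l nu : radon l ->
  (forall A, measurable A -> `|fine (nu A)| <= complex.Re `|l A|) ->
  tight (jpos nu) (jneg nu).
Proof.
move=> rl lnu E mE e e0.
have [C [cC CE lC]] := radon_inner_compact rl mE e0; exists C; split=> //.
- have mEC : measurable (E `\` C) by apply: measurableD => //; exact: compact_borel.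
  rewrite jposE//; apply: le_trans (ler_norm _) _.
  have mB := measurableI _ _ mEC (measurable_hahnP nu).
  by apply: le_trans (lnu _ mB) _; apply: lC => // x [].
- have mEC : measurable (E `\` C) by apply: measurableD => //; exact: compact_borel.
  rewrite jnegE// fineN; apply: le_trans (ler_norm _) _; rewrite normrN.
  have mB := measurableI _ _ mEC (measurable_hahnN nu).
  by apply: le_trans (lnu _ mB) _; apply: lC => // x [].
Qed.

End radon_variation.

(** * Dependence of the signed integral on the pair of measures *)

Section signed_integral_measures.
Context d (T : measurableType d) (R : realType).
Implicit Types (p q : {finite_measure set T -> \bar R}) (f g : T -> R).

Lemma Rintegral_measure_addE p q f : bmf f ->
  Rintegral (measure_add p q) setT f = Rintegral p setT f + Rintegral q setT f.
Proof.
move=> bf; have ip := bmf_integrable p bf; have iq := bmf_integrable q bf.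
by rewrite /Rintegral integral_measure_add// fineD// integrable_fin_num.
Qed.

(** Rearranged as [p' + q = p + q'], the hypothesis is an equality of positive measures, against
    which integrals agree. *)
Lemma eq_sint p q p' q' f : bmf f ->
  (forall A, measurable A -> (p A - q A = p' A - q' A)%E) ->
  sint p q f = sint p' q' f.
Proof.
move=> bf pq; apply/eqP; rewrite /sint subr_eq addrAC eq_sym subr_eq; apply/eqP.
rewrite -!Rintegral_measure_addE// /Rintegral; congr fine.
apply: eq_measure_integral => A mA _.
transitivity (p' A + q A)%E; first exact: measure_addE.
transitivity (p A + q' A)%E; last exact/esym/measure_addE.
have fK (m : {finite_measure set T -> \bar R}) := fineK (fin_num_measure m A mA).
have := pq A mA; rewrite -(fK p) -(fK q) -(fK p') -(fK q') -!EFinB -!EFinD.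
by move=> -[] e; congr EFin; lra.
Qed.

Lemma sint_swap p q f : sint q p f = - sint p q f.
Proof. by rewrite /sint opprB. Qed.

(** Since [q] does not charge [P], the integral of the positive [g] over [P] against [p] vanishes,
    which forces [p P = 0]. *)
Lemma sint_pos_null p q g (P : set T) : bmf g -> (forall x, 0 < g x) ->
  measurable P -> q P = 0 -> sint p q (fun x => g x * \1_P x) = 0 -> p P = 0.
Proof.
move=> bg g0 mP qP; have [_ [M gM]] := bg.
have bP : bmf (fun x => g x * \1_P x) by apply: bmfM => //; exact: bmf_indic.
have -> : sint p q (fun x => g x * \1_P x) =
    Rintegral p setT (fun x => g x * \1_P x).
  rewrite /sint; apply/eqP; rewrite -subr_eq0 addrAC subrr add0r oppr_eq0.
  rewrite -normr_le0.
  have h0 x : (~` P) x -> `|g x * \1_P x| <= 0.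
    by move=> Px; rewrite indicE memNset// mulr0 normr0.
  have hM x : `|g x * \1_P x| <= M.
    rewrite normrM (le_trans _ (gM x))// ler_piMr// indicE.
    by case: (_ \in _); rewrite ?normr1 ?normr0.
  have := Rintegral_small q bP (measurableC mP) h0 hM (lexx 0).
  by rewrite mul0r add0r setCK qP mulr0.
move=> I0; apply: measure_negligible => //.
have ip := bmf_integrable p bP.
set h := fun x => g x * \1_P x in I0 ip.
have h0 x : 0 <= h x by rewrite mulr_ge0// ltW.
have : (\int[p]_(x in setT) `|(EFin \o h) x| = 0)%E.
  under eq_integral do rewrite /= ger0_norm//.
  by rewrite -[LHS]fineK; [congr EFin|exact: integrable_fin_num].
move/(ae_eq_integral_abs p measurableT) => /(_ (measurable_int _ ip)) ae.
apply: negligibleS ae => x Px /= /(_ I) [].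
rewrite /h indicE mem_set// mulr1 => gx; by have := g0 x; rewrite gx ltxx.
Qed.

End signed_integral_measures.

(** * Integrals against charges, and a criterion for a charge to vanish *)

Section charge_integral.
Context {R : realType} {X : ptopologicalType}.
Local Notation T := (borelType X).
Implicit Types (nu : {charge set T -> \bar R}) (f : T -> R).

(** The Hahn decomposition chosen for [copp nu] need not be that of [nu] with its sets swapped, so
    the integrals are compared through [eq_sint]. *)
Lemma charge_integral_copp nu f : bmf f ->
  charge_integral (copp nu) f = - charge_integral nu f.
Proof.
move=> bf; rewrite !charge_integralE -sint_swap; apply: eq_sint => // A mA.
rewrite -jordanE//= /copp/= (jordanE _ mA) fin_num_oppeB 1?addeC//.
exact: fin_num_measure.
Qed.

(** Taking [E] to be each Hahn set isolates one Jordan part, which [sint_pos_null] shows to be null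
    there. *)
Lemma charge_null nu (g : T -> R) : bmf g -> (forall x, 0 < g x) ->
  (forall E : set T, measurable E ->
     sint (jpos nu) (jneg nu) (fun x => g x * \1_E x) = 0) ->
  forall E : set T, measurable E -> nu E = 0%E.
Proof.
move=> bg g0 h E mE.
have mP := measurable_hahnP nu; have mN := measurable_hahnN nu.
have P0 : jpos nu (hahnP nu) = 0%E.
  apply: (@sint_pos_null _ _ _ (jpos nu) (jneg nu) g) => //; last exact: h.
  by rewrite jnegE// hahnPN charge0 oppe0.
have N0 : jneg nu (hahnN nu) = 0%E.
  apply: (@sint_pos_null _ _ _ (jneg nu) (jpos nu) g) => //.
    by rewrite jposE// setIC hahnPN charge0.
  by rewrite sint_swap h// oppr0.
have mEP := measurableI _ _ mE mP; have mEN := measurableI _ _ mE mN.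
have pE : jpos nu E = 0%E.
  have -> : jpos nu E = jpos nu (E `&` hahnP nu) by rewrite !jposE// -setIA setIid.
  by apply/eqP; rewrite eq_le measure_ge0 andbT -P0 le_measure ?inE.
have nE : jneg nu E = 0%E.
  have -> : jneg nu E = jneg nu (E `&` hahnN nu) by rewrite !jnegE// -setIA setIid.
  by apply/eqP; rewrite eq_le measure_ge0 andbT -N0 le_measure ?inE.
by rewrite (jordanE _ mE) pE nE sube0.
Qed.

End charge_integral.

(** * Reproducing kernel Hilbert spaces and the theorem *)

Section real_kernels.
Context {R : realType}.

Lemma sum_complex (I : Type) (s : seq I) (u v : I -> R) :
  \sum_(i <- s) (u i +i* v i) = (\sum_(i <- s) u i) +i* (\sum_(i <- s) v i).
Proof.
elim: s => [|i s IH]; first by rewrite !big_nil.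
by rewrite !big_cons IH.
Qed.

(** Split the coefficients into real and imaginary parts: the real part of the sum is a sum of two
    real forms, and symmetry of [k] cancels the imaginary part. *)
Lemma pos_def_kernel_real (X : Type) (k : X -> X -> R) : psd k ->
  pos_def_kernel (fun x y => (k x y)%:C).
Proof.
move=> [ks k0] n x c _.
pose a i := complex.Re (c i); pose b i := complex.Im (c i).
have cE i j : c i * (c j)^* * (k (x i) (x j))%:C =
    ((a i * a j + b i * b j) * k (x i) (x j)) +i*
    ((b i * a j - a i * b j) * k (x i) (x j)).
  rewrite /a /b; case: (c i) => a1 b1; case: (c j) => a2 b2.
  by apply/eqP; rewrite eq_complex /=; apply/andP; split; apply/eqP; ring.
under eq_bigr do under eq_bigr do rewrite cE.
under eq_bigr do rewrite sum_complex.
rewrite sum_complex lecE /=; apply/andP; split.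
  apply/eqP; under eq_bigr do under eq_bigr do rewrite mulrBl.
  under eq_bigr do rewrite sumrB.
  rewrite sumrB; apply/eqP; rewrite subr_eq0; apply/eqP.
  rewrite exchange_big/=; apply: eq_bigr => i _; apply: eq_bigr => j _.
  by rewrite ks (mulrC (b j)).
have kE (d : 'I_n -> R) : \sum_(i < n) \sum_(j < n) d i * d j * k (x i) (x j) =
    kform k [seq (d i, x i) | i <- index_enum 'I_n].
  by rewrite /kform big_map; apply: eq_bigr => i _; rewrite big_map.
under eq_bigr do under eq_bigr do rewrite mulrDl.
under eq_bigr do rewrite big_split/=.
by rewrite big_split/= !kE addr_ge0.
Qed.

(** * Continuity of the functions in a reproducing kernel Hilbert space *)

Section rkhs_continuity.
Context {X : topologicalType} (k : X -> X -> R).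
Local Notation K := (fun x y : X => (k x y)%:C).
Context (H : set (X -> R[i])) (ip : (X -> R[i]) -> (X -> R[i]) -> R[i]).
Hypothesis rkhsK : rkhs K H ip.
Implicit Types (f h : X -> R[i]).

Lemma rkhs_Re_ipC f h : H f -> H h -> complex.Re (ip f h) = complex.Re (ip h f).
Proof. by move=> Hf Hh; rewrite (rkhs_ipC rkhsK Hf Hh); case: (ip h f). Qed.

Lemma rkhs_Re_ip_lin (s : R) f g h : H f -> H g -> H h ->
  complex.Re (ip (fun x => s%:C * f x + g x) h) =
  s * complex.Re (ip f h) + complex.Re (ip g h).
Proof.
move=> Hf Hg Hh; rewrite (rkhs_iplin rkhsK) //.
by case: (ip f h) => a b; case: (ip g h) => a' b' /=; ring.
Qed.

Lemma rkhs_Re_ip_ge0 f : H f -> 0 <= complex.Re (ip f f).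
Proof.
move=> Hf; have [f0|/(rkhs_ip_gt0 rkhsK Hf)] := pselect (f = fun=> 0); last first.
  by rewrite ltcE => /andP[_ /ltW].
(* For [f = 0], linearity makes the real part of [ip f f] equal to its own double. *)
have := rkhs_Re_ip_lin 1 Hf Hf Hf.
rewrite (_ : (fun x => 1%:C * f x + f x) = f); first by rewrite mul1r; lra.
by apply/funext => x; rewrite f0 mulr0 addr0.
Qed.

Lemma rkhs_CS f h : H f -> H h ->
  complex.Re (ip f h) ^+ 2 <= complex.Re (ip h h) * complex.Re (ip f f).
Proof.
move=> Hf Hh; apply: discr_le => [|s]; first exact: rkhs_Re_ip_ge0.
have Hs : H (fun x => s%:C * f x + h x) := rkhs_lin rkhsK s%:C Hf Hh.
have := rkhs_Re_ip_ge0 Hs; rewrite rkhs_Re_ip_lin//.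
rewrite (rkhs_Re_ipC Hf Hs) (rkhs_Re_ipC Hh Hs) !rkhs_Re_ip_lin//.
by rewrite (rkhs_Re_ipC Hh Hf); congr (_ <= _); ring.
Qed.

(** Cauchy-Schwarz for [f] against the difference of the kernel sections at [y] and [y'], with which
    its inner product is [f y - f y']. *)
Lemma rkhs_Re_dist f y y' : H f ->
  (complex.Re (f y) - complex.Re (f y')) ^+ 2 <=
  (k y y - k y y' - (k y' y - k y' y')) * complex.Re (ip f f).
Proof.
move=> Hf; pose h x := (-1)%:C * K x y' + K x y.
have Hy := rkhs_kernel rkhsK y; have Hy' := rkhs_kernel rkhsK y'.
have Hh : H h := rkhs_lin rkhsK (-1)%:C Hy' Hy.
have E u : H u -> complex.Re (ip u h) = complex.Re (u y) - complex.Re (u y').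
  move=> Hu; rewrite (rkhs_Re_ipC Hu Hh) rkhs_Re_ip_lin//.
  rewrite (rkhs_Re_ipC Hy Hu) (rkhs_Re_ipC Hy' Hu).
  by rewrite !(rkhs_reproducing rkhsK)// mulN1r addrC.
have := rkhs_CS Hf Hh; rewrite (E _ Hf) (E _ Hh) /h /=.
by congr (_ <= _ * _); ring.
Qed.

Lemma rkhs_Re_continuous f : (forall x y, k x y = k y x) ->
  (forall x, continuous (k x)) -> continuous (fun x => k x x) -> H f ->
  continuous (fun x => complex.Re (f x)).
Proof.
move=> ks kc kd Hf y; set A := complex.Re (ip f f).
have A0 : 0 <= A := rkhs_Re_ip_ge0 Hf.
have c : (k y y - k y y' - (k y' y - k y' y')) * A @[y' --> y] --> 0.
  rewrite [X in _ --> X](_ : _ = (k y y - k y y - (k y y - k y y)) * A); last by ring.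
  apply: cvgMl; apply: cvgB; apply: cvgB.
  - exact: cvg_cst.
  - exact: kc.
  - by under eq_fun do rewrite ks; exact: kc.
  - exact: kd.
apply/cvgrPdist_le => e e0; have e2 : 0 < e ^+ 2 by rewrite exprn_gt0.
move/cvgr0Pnorm_le : c => /(_ _ e2); apply: filterS => y' h.
rewrite -(@ler_pXn2r _ 2)// ?nnegrE// ?(ltW e0)//.
rewrite real_normK ?num_real//; apply: le_trans (rkhs_Re_dist y y' Hf) _.
exact: le_trans (ler_norm _) h.
Qed.

Lemma rkhs_continuousC f : (forall x y, k x y = k y x) ->
  (forall x, continuous (k x)) -> continuous (fun x => k x x) -> H f ->
  continuousC f.
Proof.
move=> ks kc kd Hf; split; first exact: rkhs_Re_continuous.
(* The imaginary part of [f] is the real part of [- i f], which also lies in [H]. *)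
have Hif : H (fun x => (- 'i) * f x + 0) := rkhs_lin rkhsK _ Hf (rkhs0 rkhsK).
rewrite (_ : (fun x => complex.Im (f x)) =
  (fun x => complex.Re ((- 'i) * f x + 0))); first exact: rkhs_Re_continuous Hif.
by apply/funext => x; case: (f x) => a b /=; ring.
Qed.

End rkhs_continuity.

Lemma cintegral_real (X : ptopologicalType) (l : @cmeasure R X) (f : X -> R) :
  cintegral l (fun x => (f x)%:C) =
  charge_integral (cmeasure_Re l) f +i* charge_integral (cmeasure_Im l) f.
Proof.
have c0 (nu : {charge set (borelType X) -> \bar R}) :
    charge_integral nu (fun=> 0) = 0.
  by rewrite /charge_integral !Rintegral_cst// !mul0r subrr.
by rewrite /cintegral /= !c0 subr0 add0r.
Qed.

Definition energy (X : ptopologicalType) (k : X -> X -> R)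
    (nu : {charge set (borelType X) -> \bar R}) : R :=
  charge_integral nu (fun y => charge_integral nu (fun x => k x y)).

(** The conjugate measure turns the minus sign in the real part into a plus; cross terms between the
    two charges enter only the imaginary part. *)
Lemma cintegral_energy (X : ptopologicalType) (l : @cmeasure R X)
    (k : X -> X -> R) : regular_kernel k ->
  complex.Re (cintegral (cmeasure_conj l)
    (fun y => cintegral l (fun x => (k x y)%:C))) =
  energy k (cmeasure_Re l) + energy k (cmeasure_Im l).
Proof.
move=> nk; rewrite (_ : (fun y => _) = (fun y =>
  charge_integral (cmeasure_Re l) (fun x => k x y) +i*
  charge_integral (cmeasure_Im l) (fun x => k x y))); last first.
  by apply/funext => y; rewrite cintegral_real.
rewrite /cintegral /= charge_integral_copp ?opprK//.
exact: (regular_bmf_sint _ _ nk).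
Qed.

End real_kernels.

(** * Tight charges of zero energy on the hyperbolic space *)

Section hyperbolic_charges.
Context {R : realType} {V : hilbertType R}.
Local Notation X := (hyperbolic V).
Local Notation T := (borelType X).
Context (r : R) (r_gt0 : 0 < r) (nu : {charge set T -> \bar R}).
Hypothesis tight_nu : tight (jpos nu) (jneg nu).

Lemma hyperbolic_hausdorff : hausdorff_space X.
Proof. exact: metric_hausdorff. Qed.

Lemma energy_hexp_eq0 sg : 0 < sg -> energy (@hkernel R V r) nu = 0 ->
  energy (hexp r sg) nu = 0.
Proof.
move=> s0 H0; have [c c0 nD] := regular_hkernel_sub_hexp r_gt0 s0 (V := V).
have nE := @regular_hexp R V r sg r_gt0 (ltW s0).
have hX := hyperbolic_hausdorff.
set p := jpos nu; set q := jneg nu.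
have D0 : 0 <= energy (fun z w => hkernel r z w - c * hexp r sg z w) nu.
  exact: (regular_sint_ge0 hX nD tight_nu).
have E0 : 0 <= energy (hexp r sg) nu := regular_sint_ge0 hX nE tight_nu.
have : energy (@hkernel R V r) nu =
    energy (fun z w => hkernel r z w - c * hexp r sg z w) nu +
    c * energy (hexp r sg) nu.
  rewrite /energy !charge_integralE -sintZ; last exact: (regular_bmf_sint _ _ nE).
  rewrite -sintD; [|exact: (regular_bmf_sint _ _ nD)|]; last first.
    by apply: bmfZ; exact: (regular_bmf_sint _ _ nE).
  congr sint; apply/funext => w; rewrite !charge_integralE -sintZ; last first.
    exact: (regular_bmf nE).
  rewrite -sintD; [|exact: (regular_bmf nD)|]; last first.
    by apply: bmfZ; exact: (regular_bmf nE).
  by congr sint; apply/funext => z; rewrite subrK.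
rewrite H0 => /esym/eqP; rewrite paddr_eq0 ?mulr_ge0 ?(ltW c0)// => /andP[_].
by rewrite mulf_eq0 gt_eqF//= => /eqP.
Qed.

Lemma energy_hkernel_eq0 : energy (@hkernel R V r) nu = 0 ->
  forall E : set T, measurable E -> nu E = 0%E.
Proof.
move=> H0; have hX := hyperbolic_hausdorff.
have bg : bmf (hweight r : T -> R).
  split; first by apply: continuous_borel; exact: hweight_continuous.
  by exists 1 => z; rewrite ger0_norm ?hweight_le1 ?ltW ?hweight_gt0.
apply: (charge_null bg); first exact: hweight_gt0.
apply: (exponential_uniqueness hX tight_nu (l := @klein_form R V)) => //.
- exact: klein_formD.
- exact: klein_formZ.
- exact: klein_form_bounded.
- exact: klein_form_continuous.
- exact: klein_form_separates.
move=> v; have [sg [w [s0 E]]] := klein_formE v.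
have nE := @regular_hexp R V r sg r_gt0 (ltW s0).
(* The section of [hexp r sg] at [w] is the wanted integrand up to the positive constant
   [hweight r w]. *)
have := regular_sint_eq0 hX nE w tight_nu (energy_hexp_eq0 s0 H0).
have bGE : bmf (fun z : T => hweight r z * expR (klein_form v z)).
  apply: bmfM => //; apply: bmf_expl.
  - exact: klein_form_bounded.
  - exact: klein_form_continuous.
rewrite (_ : (fun z => _) =
    fun z : T => hweight r w * (hweight r z * expR (klein_form v z))); last first.
  by apply/funext => z; rewrite /hexp E; ring.
by rewrite sintZ// => /eqP; rewrite mulf_eq0 gt_eqF ?hweight_gt0//= => /eqP.
Qed.

End hyperbolic_charges.

Theorem theorem6p1 (R : realType) (V : hilbertType R) (r : R) (r_gt0 : 0 < r) :
  (forall z w : hyperbolic V, hkernel r z w = sech (mdist z w) `^ r) /\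
  ISPD (fun z w : hyperbolic V => (hkernel r z w)%:C).
Proof.
have nH := @regular_hkernel R V r r_gt0; have [pH _ cH dH] := nH.
have hX := @hyperbolic_hausdorff R V.
split=> [z w|].
  rewrite hyp_mdistE /sech arccoshK ?bracket_ge1// -powR_inv1; last first.
    by rewrite (le_trans ler01)// bracket_ge1.
  by rewrite -powRrM mulN1r.
split=> //.
- exists 1 => z w; rewrite normc_def /= expr0n addr0 sqrtr_sqr lecR.
  rewrite -(@ler_pXn2r _ 2)// ?nnegrE// real_normK ?num_real// expr1n.
  by have := psd_CS z w pH; rewrite !hkernelxx mulr1.
- exact: pos_def_kernel_real.
- move=> H ip rH f Hf; apply: (rkhs_continuousC rH) => //.
  exact: pH.1.
- move=> l rl Q0 E mE.
  have tRe : tight (jpos (cmeasure_Re l)) (jneg (cmeasure_Re l)).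
    by apply: (radon_tight hX rl) => A _; exact: (normr_Re_le (l A)).
  have tIm : tight (jpos (cmeasure_Im l)) (jneg (cmeasure_Im l)).
    by apply: (radon_tight hX rl) => A _; exact: (normr_Im_le (l A)).
  (* The vanishing double integral has as real part a sum of two nonnegative energies, so both are
     zero. *)
  have := cintegral_energy l nH; rewrite Q0 /= => /esym/eqP.
  rewrite paddr_eq0; last 2 first.
  - exact: (regular_sint_ge0 hX nH tRe).
  - exact: (regular_sint_ge0 hX nH tIm).
  move=> /andP[/eqP re0 /eqP im0]; rewrite /cmeasure_val.
  rewrite (energy_hkernel_eq0 r_gt0 tRe re0 mE).
  by rewrite (energy_hkernel_eq0 r_gt0 tIm im0 mE).
Qed.
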